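(* Let $(\mathcal{A},A,A')$ be a quasi-twilled associative algebra with multiplication $\Omega=\pi+\xi+\eta+\beta+\rho+\mu+\theta$. Then there is a $V$-data $(L,F,P,\Delta)$ as follows: (i) the graded Lie algebra $(L,[\cdot,\cdot])$ is $\left(\bigoplus_{n=0}^{+\infty}\mathrm{Hom}(\otimes^{n+1}(A\oplus A'),A\oplus A'),[\cdot,\cdot]_G\right)$; (ii) the abelian graded Lie subalgebra is $F=\bigoplus_{n=0}^{+\infty}\mathrm{Hom}(\otimes^{n+1}A',A)$; (iii) $P:L\to L$ is the projection onto the subspace $F$; (iv) $\Delta=\pi+\xi+\eta+\beta+\rho+\mu+\theta$. Consequently, $\left(\bigoplus_{n=0}^{+\infty}\mathrm{Hom}(\otimes^{n+1}A',A),l_1,l_2,l_3\right)$ is an $L_\infty$-algebra, where $$l_1(f)=[\xi+\eta+\beta,f]_G,\qquad l_2(f_1,f_2)=[[\pi+\rho+\mu,f_1]_G,f_2]_G,\qquad l_3(f_1,f_2,f_3)=[[[\theta,f_1]_G,f_2]_G,f_3]_G$$ for all $f\in\mathrm{Hom}(\otimes^mA',A)$ and $f_i\in\mathrm{Hom}(\otimes^{m_i}A',A)$, $i=1,2,3$ (and $l_k=0$ for $k\ge4$). Furthermore, a linear map $B:A'\to A$ is a left deformation map of $(\mathcal{A},A,A')$ if and only if $B$ is a Maurer-Cartan element of this $L_\infty$-algebra.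
   Context: All vector spaces are over a field $\mathbb{K}$ of characteristic $0$; associative algebras are not assumed unital. Gerstenhaber bracket: for a vector space $W$, $\bigoplus_{n\ge0}\mathrm{Hom}(\otimes^{n+1}W,W)$ is graded by giving $\mathrm{Hom}(\otimes^{n+1}W,W)$ degree $n$. For $f\in\mathrm{Hom}(\otimes^mW,W)$, $g\in\mathrm{Hom}(\otimes^nW,W)$, $[f,g]_G=f\circ g-(-1)^{(m-1)(n-1)}g\circ f$, where $f\circ g(x_1,\dots,x_{m+n-1})=\sum_{i=1}^m(-1)^{(i-1)(n-1)}f(x_1,\dots,x_{i-1},g(x_i,\dots,x_{i+n-1}),x_{i+n},\dots,x_{m+n-1})$. This is a graded Lie algebra. Lift convention: a multilinear map $f$ from a tensor product of copies of $A$ and $A'$ (in a fixed order) to $A$ or $A'$ is regarded as an element of $\mathrm{Hom}(\otimes^n(A\oplus A'),A\oplus A')$ by extending it by zero on all other tensor components. So $\mathrm{Hom}(\otimes^n(A\oplus A'),A\oplus A')$ is the direct sum of all such component spaces, and $P$ is the projection onto the components $\mathrm{Hom}(\otimes^{n+1}A',A)$ along all other components. A quasi-twilled associative algebra $(\mathcal{A},A,A')$ is an associative algebra $(\mathcal{A},\Omega)$ with a vector space decomposition $\mathcal{A}=A\oplus A'$ such that $A'$ is a subalgebra. Then uniquely $\Omega=\pi+\xi+\eta+\beta+\rho+\mu+\theta$ with $\pi\in\mathrm{Hom}(A\otimes A,A)$, $\xi\in\mathrm{Hom}(A\otimes A',A)$, $\eta\in\mathrm{Hom}(A'\otimes A,A)$,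 $\beta\in\mathrm{Hom}(A'\otimes A',A')$, $\rho\in\mathrm{Hom}(A\otimes A',A')$, $\mu\in\mathrm{Hom}(A'\otimes A,A')$, $\theta\in\mathrm{Hom}(A\otimes A,A')$, i.e. $\Omega((x,u),(y,v))=(\pi(x,y)+\xi(x,v)+\eta(u,y),\ \beta(u,v)+\rho(x,v)+\mu(u,y)+\theta(x,y))$ for $x,y\in A$, $u,v\in A'$. A left deformation map of $(\mathcal{A},A,A')$ is a linear map $B:A'\to A$ such that for all $u,v\in A'$: $\pi(B(u),B(v))+\xi(B(u),v)+\eta(u,B(v))=B(\beta(u,v)+\rho(B(u),v)+\mu(u,B(v))+\theta(B(u),B(v)))$. A $V$-data is a quadruple $(L,F,P,\Delta)$ where $(L=\bigoplus L^i,[\cdot,\cdot])$ is a graded Lie algebra, $F$ is an abelian graded Lie subalgebra of $L$, $P:L\to L$ is a projection ($P\circ P=P$) whose image is $F$ and whose kernel is a graded Lie subalgebra of $L$, and $\Delta\in\ker(P)\cap L^1$ satisfies $[\Delta,\Delta]=0$. An $L_\infty$-algebra is a $\mathbb{Z}$-graded vector space $\mathfrak{g}$ with linear maps $l_k:\otimes^k\mathfrak{g}\to\mathfrak{g}$ ($k\ge1$) of degree $1$ that are graded symmetric, $l_n(x_{\sigma(1)},\dots,x_{\sigma(n)})=\varepsilon(\sigma)l_n(x_1,\dots,x_n)$ for $\sigma\in S_n$, and satisfy for all $n\ge1$: $\sum_{i=1}^n\sum_{\sigma\in S(i,n-i)}\varepsilon(\sigma)l_{n-i+1}(l_i(x_{\sigma(1)},\dots,x_{\sigma(i)}),x_{\sigma(i+1)},\dots,x_{\sigma(n)})=0$,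 where $\varepsilon(\sigma)$ is the Koszul sign, $S(i,n-i)$ is the set of $(i,n-i)$-shuffles, and the $x_j$ are homogeneous. A Maurer-Cartan element is a degree $0$ element $x$ with $\sum_{k\ge1}\frac{1}{k!}l_k(x,\dots,x)=0$. Here $\mathrm{Hom}(\otimes^{n+1}A',A)$ has degree $n$. *)

(* Defs.v *)
From HB Require Import structures.
From mathcomp Require Import all_boot all_order all_algebra perm zify.
From mathcomp Require Import boolp classical_sets functions.

Set Implicit Arguments.
Unset Strict Implicit.
Unset Printing Implicit Defensive.

Import Order.TTheory GRing.Theory Num.Theory.
Local Open Scope ring_scope.

(* Multilinear maps of all arities at once: a word [:: x1; ...; xn] stands for
   the pure tensor x1 (x) ... (x) xn, so that a function on words is a family,
   indexed by the length n, of functions of n arguments.                      *)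
Definition multilinear (K : fieldType) (U V : lmodType K) (f : seq U -> V) :=
  forall (s t : seq U) (a : K) (x y : U),
    f (s ++ (a *: x + y) :: t) = a *: f (s ++ x :: t) + f (s ++ y :: t).

(* The direct sum over n >= 0 of Hom(U^{(x) n+1}, V): there is no component of
   arity 0, and only finitely many components are nonzero.                    *)
Definition multimap_axiom (K : fieldType) (U V : lmodType K) (f : seq U -> V) :=
  [/\ f [::] = 0, multilinear f &
      exists N : nat, forall s, (N <= size s)%N -> f s = 0].

Definition multimap_pred (K : fieldType) (U V : lmodType K) :
  {pred (seq U -> V)} := fun f => `[< multimap_axiom f >].

Lemma multimap_closed (K : fieldType) (U V : lmodType K) :
  submod_closed (@multimap_pred K U V).
Proof.
split=> [|a f g /asboolP [f0 fl [M fM]] /asboolP [g0 gl [N gN]]].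
  apply/asboolP; split=> //; last by exists 0%N.
  by move=> s t a x y /=; rewrite scaler0 addr0.
have E s : (a *: f + g) s = a *: f s + g s by [].
apply/asboolP; split.
- by rewrite E f0 g0 scaler0 addr0.
- move=> s t b x y; rewrite !E fl gl !scalerDr !scalerA mulrC.
  by rewrite addrACA.
exists (maxn M N) => s; rewrite geq_max => /andP[sM sN].
by rewrite E fM // gN // scaler0 addr0.
Qed.

HB.instance Definition _ (K : fieldType) (U V : lmodType K) :=
  GRing.isSubmodClosed.Build K (seq U -> V) (@multimap_pred K U V)
    (@multimap_closed K U V).

Record multimap (K : fieldType) (U V : lmodType K) := Multimap {
  multimap_fun :> seq U -> V;
  _ : multimap_fun \in @multimap_pred K U V }.

HB.instance Definition _ (K : fieldType) (U V : lmodType K) :=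
  [isSub for @multimap_fun K U V].
HB.instance Definition _ (K : fieldType) (U V : lmodType K) :=
  [Choice of multimap U V by <:].
HB.instance Definition _ (K : fieldType) (U V : lmodType K) :=
  [SubChoice_isSubLmodule of multimap U V by <:].

Section Multimap.
Variables (K : fieldType).
Implicit Types U V W X : lmodType K.

Lemma multimapP U V (f : multimap U V) : multimap_axiom f.
Proof. by case: f => f /= /asboolP. Qed.

Definition mk_multimap U V (f : seq U -> V) (hf : multimap_axiom f) :
  multimap U V := Multimap (asboolT hf : f \in @multimap_pred K U V).

(* Hom(U^{(x) n+1}, V) has degree n; for i < 0 the component is zero.         *)
Definition multimap_deg U V (i : int) : set (multimap U V) :=
  [set f : multimap U V | forall s, (size s)%:Z != i + 1 -> f s = 0].

Lemma mcomp_subproof U U' V V' (r : {linear V' -> V}) (f : multimap U' V')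
  (p : {linear U -> U'}) : multimap_axiom (fun s => r (f [seq p x | x <- s])).
Proof.
have [f0 fl [N fN]] := multimapP f; split=> [|s t a x y|].
- by rewrite /= f0 linear0.
- by rewrite !map_cat /= linearP fl linearP.
by exists N => s sN; rewrite fN ?size_map // linear0.
Qed.
Definition mcomp U U' V V' (r : {linear V' -> V}) (f : multimap U' V')
  (p : {linear U -> U'}) : multimap U V := mk_multimap (mcomp_subproof r f p).

Lemma unary_subproof U V (B : {linear U -> V}) :
  multimap_axiom (fun s => if s is [:: x] then B x else 0).
Proof.
split=> [//|s t a x y|]; last by exists 2 => -[|x [|y s]].
case: s => [|z s] /=; last by case: s => *; rewrite scaler0 addr0.
by case: t => [|z t]; rewrite ?linearP ?scaler0 ?addr0.
Qed.
Definition unary U V (B : {linear U -> V}) : multimap U V :=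
  mk_multimap (unary_subproof B).

Lemma binary_subproof U V (f : {bilinear U -> U -> V}) :
  multimap_axiom (fun s => if s is [:: x; y] then f x y else 0).
Proof.
split=> [//|s t a x y|]; last by exists 3 => -[|x [|y [|z s]]].
case: s => [|z [|w s]] /=.
- case: t => [|z [|w t]]; rewrite ?scaler0 ?addr0 //.
  by rewrite linearPl.
- by case: t => [|w t]; rewrite ?linearPr ?scaler0 ?addr0.
by case: s => *; rewrite scaler0 addr0.
Qed.
Definition binary U V (f : {bilinear U -> U -> V}) : multimap U V :=
  mk_multimap (binary_subproof f).

(* The composition f o g of an m-ary f with an n-ary g, evaluated on a word of
   length m + n - 1.  The index i starts at 0, hence the sign (-1)^{i(n-1)}.  *)
Definition circ_at W (m n : nat) (f g : seq W -> W) (s : seq W) : W :=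
  \sum_(i < m) (-1) ^+ (i * n.-1) *:
     f (take i s ++ g (take n (drop i s)) :: drop (i + n) s).

(* Bilinear extension to the direct sum: on a word s, the components of f and
   g that contribute are those of arity m.+1 and n, m.+1 + n - 1 = size s.    *)
Definition gerstenhaber_fun W (f g : seq W -> W) (s : seq W) : W :=
  \sum_(m < size s) let n := (size s - m)%N in
     (circ_at m.+1 n f g s - (-1) ^+ (m * n.-1) *: circ_at n m.+1 g f s).

Lemma circ_at_multilinear W m n (f g : multimap W W) s t a x y :
  (0 < m)%N -> (0 < n)%N -> (size s + size t).+2 = (m + n)%N ->
  circ_at m n f g (s ++ (a *: x + y) :: t) =
  a *: circ_at m n f g (s ++ x :: t) + circ_at m n f g (s ++ y :: t).
Proof.
move=> m0 n0 Est; rewrite /circ_at scaler_sumr -big_split /=.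
have [_ fl _] := multimapP f; have [_ gl _] := multimapP g.
apply: eq_bigr => i _; rewrite scalerA mulrC -scalerA -scalerDr; congr (_ *: _).
have [lt_si|le_is] := ltnP (size s) i.
  have E z : take i (s ++ z :: t) = s ++ z :: take (i - size s).-1 t.
    rewrite take_cat ltnNge (ltnW lt_si) /=; congr (_ ++ _).
    by case: (i - size s)%N (subn_gt0 (size s) i) => [|k] //=; rewrite lt_si.
  have F k z : (size s < k)%N ->
      drop k (s ++ z :: t) = drop (k - size s).-1 t.
    move=> lt_sk; rewrite drop_cat ltnNge (ltnW lt_sk) /=.
    by case: (k - size s)%N (subn_gt0 (size s) k) => [|j] //=; rewrite lt_sk.
  by rewrite !E !F ?ltn_addr // -!catA /= fl.
have [lt_ns|le_ns] := ltnP (size s) (i + n).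
  have E z : take n (drop i (s ++ z :: t)) =
     drop i s ++ z :: take (n - (size s - i)).-1 t.
    have -> : drop i (s ++ z :: t) = drop i s ++ z :: t.
      rewrite drop_cat; case: ltngtP le_is => // -> _.
      by rewrite subnn drop0 drop_size.
    have lt_d : (size s - i < n)%N by rewrite ltn_subLR // addnC.
    rewrite take_cat size_drop ltnNge (ltnW lt_d) /=; congr (_ ++ _).
    case: (n - (size s - i))%N (subn_gt0 (size s - i) n) => [|k] //=.
    by rewrite lt_d.
  have F z : drop (i + n) (s ++ z :: t) = drop (i + n - size s).-1 t.
    rewrite drop_cat ltnNge (ltnW lt_ns) /=.
    case: (i + n - size s)%N (subn_gt0 (size s) (i + n)) => [|j] //=.
    by rewrite lt_ns.
  have G z : take i (s ++ z :: t) = take i s.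
    rewrite take_cat; case: ltngtP le_is => // -> _.
    by rewrite subnn take0 cats0 take_size.
  by rewrite !E !F !G gl fl.
have E z : take n (drop i (s ++ z :: t)) = take n (drop i s).
  rewrite drop_cat; case: ltngtP le_is => [lt_is _|//|Ei _].
    rewrite take_cat size_drop; case: ltngtP => //.
      by rewrite ltnNge leq_subRL ?(ltnW lt_is) // le_ns.
    by move=> ->; rewrite subnn take0 cats0 -size_drop take_size.
  by rewrite Ei -{2}(addn0 (size s)) leq_add2l leqNgt n0 in le_ns.
have F z : drop (i + n) (s ++ z :: t) = drop (i + n) s ++ z :: t.
  rewrite drop_cat; case: ltngtP le_ns => // -> _.
  by rewrite subnn drop0 drop_size.
have G z : take i (s ++ z :: t) = take i s.
  rewrite take_cat; case: ltngtP le_is => // -> _.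
  by rewrite subnn take0 cats0 take_size.
by rewrite !E !F !G -!cat_rcons -!cats1 !catA /= -!(catA _ [:: _] t) /= fl.
Qed.

Lemma circ_at_big W m n N (f g : multimap W W) s :
  (0 < m)%N -> (0 < n)%N -> (size s).+1 = (m + n)%N ->
  (forall t, (N <= size t)%N -> f t = 0) ->
  (forall t, (N <= size t)%N -> g t = 0) ->
  (N + N <= size s)%N -> circ_at m n f g s = 0.
Proof.
move=> m0 n0 Es fN gN Ns; rewrite /circ_at big1 // => i _.
have [_ fl _] := multimapP f.
have f0 u v : f (u ++ 0 :: v) = 0.
  have /eqP := fl u v 1 0 0.
  by rewrite !scale1r addr0 -subr_eq subrr => /eqP <-.
have le_in : (i + n <= size s)%N.
  by rewrite -ltnS Es ltn_add2r.
have [leNn|lt_nN] := leqP N n.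
  rewrite (gN (take n _)) ?f0 ?scaler0 // size_takel // size_drop.
  by rewrite leq_subRL // (leq_trans _ le_in) // leq_addr.
rewrite fN ?scaler0 // size_cat /= size_takel; last first.
  by apply: leq_trans le_in; apply: leq_addr.
rewrite size_drop subnDA addnS.
by lia.
Qed.

Lemma gerstenhaber_subproof W (f g : multimap W W) :
  multimap_axiom (gerstenhaber_fun f g).
Proof.
split=> [|s t a x y|]; first by rewrite /gerstenhaber_fun big_ord0.
  rewrite /gerstenhaber_fun !size_cat /= scaler_sumr -big_split /=.
  apply: eq_bigr => m _.
  have n0 : (0 < size s + (size t).+1 - m)%N by rewrite subn_gt0.
  have Em : (m.+1 + (size s + (size t).+1 - m) = (size s + size t).+2)%N.
    by have := ltn_ord m; lia.
  rewrite !circ_at_multilinear -?Em //; last exact: addnC.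
  rewrite scalerDr scalerBr opprD !scalerA [a * _]mulrC.
  by rewrite addrACA.
have [_ _ [M fM]] := multimapP f; have [_ _ [N gN]] := multimapP g.
have fMN t : (maxn M N <= size t)%N -> f t = 0.
  by rewrite geq_max => /andP[/fM].
have gMN t : (maxn M N <= size t)%N -> g t = 0.
  by rewrite geq_max => /andP[_ /gN].
exists (maxn M N + maxn M N)%N => s Hs.
rewrite /gerstenhaber_fun big1 // => m _.
have n0 : (0 < size s - m)%N by rewrite subn_gt0.
have Em : (m.+1 + (size s - m) = (size s).+1)%N.
  by rewrite addSn subnKC // ltnW.
rewrite (circ_at_big _ _ _ fMN gMN) // (circ_at_big _ _ _ gMN fMN) //.
  by rewrite scaler0 subrr.
by rewrite addnC.
Qed.

Definition gerstenhaber W (f g : multimap W W) : multimap W W :=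
  mk_multimap (gerstenhaber_subproof f g).

Lemma gerstenhaber_homog W (m n : nat) (f g : multimap W W) s :
  multimap_deg m%:Z f -> multimap_deg n%:Z g -> size s = (m + n).+1 ->
  gerstenhaber f g s =
  circ_at m.+1 n.+1 f g s - (-1) ^+ (m * n) *: circ_at n.+1 m.+1 g f s.
Proof.
move=> fm gn Es.
have lt_m : (m < size s)%N by rewrite Es ltnS leq_addr.
rewrite /= /gerstenhaber_fun (bigD1 (Ordinal lt_m)) //= big1 ?addr0.
  by rewrite Es -addnS addKn.
move=> k neq_km.
have szE i p q : (p + q = (size s).+1)%N -> (i < p)%N -> (0 < q)%N ->
    forall w : W, size (take i s ++ w :: drop (i + q) s) = p.
  move=> Epq lt_ip q0 w.
  have le_iq : (i + q <= size s)%N by rewrite -ltnS -Epq ltn_add2r.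
  rewrite size_cat /= size_takel ?(leq_trans (leq_addr q i)) // size_drop.
  apply/eqP; rewrite addnS -(eqn_add2r q) Epq addSn eqSS -addnA addnC.
  by rewrite -addnA [(q + i)%N]addnC subnK.
have Ek : (k.+1 + (size s - k) = (size s).+1)%N.
  by rewrite addSn subnKC // ltnW.
have nk0 : (0 < size s - k)%N by rewrite subn_gt0.
have neq : k.+1 != m.+1 by rewrite eqSS -(inj_eq val_inj) in neq_km *.
have neq' : (size s - k)%N != n.+1.
  by apply: contra neq => /eqP E; apply/eqP; lia.
rewrite /circ_at !big1 ?scaler0 ?subrr // => i _.
  by rewrite gn ?scaler0 // (szE _ (size s - k)%N) // 1?addnC // -PoszD eqz_nat addn1.
by rewrite fm ?scaler0 // (szE _ k.+1) // -PoszD eqz_nat addn1.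
Qed.

End Multimap.

Section GradedStructures.
Variables (K : fieldType) (V : lmodType K) (h : int -> set V).

Definition subspace (S : set V) :=
  S 0 /\ forall (a : K) x y, S x -> S y -> S (a *: x + y).

Definition graded_subspace (S : set V) :=
  subspace S /\
  forall v, S v -> exists (r : seq int) (c : int -> V),
    [/\ uniq r, forall i, h i (c i), forall i, S (c i)
      & v = \sum_(i <- r) c i].

(* V is the direct sum of the h i.                                            *)
Definition graded_vect :=
  [/\ forall i, subspace (h i), graded_subspace setT &
      forall (r : seq int) (c : int -> V), uniq r -> (forall i, h i (c i)) ->
        \sum_(i <- r) c i = 0 -> forall i, i \in r -> c i = 0].

Variable br : V -> V -> V.

Record graded_Lie : Prop := GradedLie {
  graded_Lie_vect : graded_vect;
  graded_Lie_bilinear : bilinear_for *:%R *:%R br;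
  graded_Lie_deg : forall i j x y, h i x -> h j y -> h (i + j) (br x y);
  graded_Lie_antisym : forall i j x y, h i x -> h j y ->
    br x y = - ((-1) ^ (i * j) *: br y x);
  graded_Lie_jacobi : forall i j k x y z, h i x -> h j y -> h k z ->
    br x (br y z) = br (br x y) z + (-1) ^ (i * j) *: br y (br x z) }.

Definition graded_Lie_sub (S : set V) :=
  graded_subspace S /\ forall x y, S x -> S y -> S (br x y).

Record V_data (F : set V) (P : V -> V) (D : V) : Prop := VData {
  V_data_Lie : graded_Lie;
  V_data_sub : graded_Lie_sub F;
  V_data_abelian : forall x y, F x -> F y -> br x y = 0;
  V_data_linear : linear P;
  V_data_idem : forall x, P (P x) = P x;
  V_data_image : range P = F;
  V_data_kernel : graded_Lie_sub [set x | P x = 0];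
  V_data_ker : P D = 0;
  V_data_deg1 : h 1 D;
  V_data_square : br D D = 0 }.

(* x_{sigma(0)} ... x_{sigma(n-1)} as a word, and the sign such that
   x_0 ... x_{n-1} = koszul d sigma x_{sigma(0)} ... x_{sigma(n-1)} in the
   graded symmetric algebra when x_i has degree d i.                          *)
Definition perm_word n (x : 'I_n -> V) (sigma : 'S_n) : seq V :=
  [seq x (sigma i) | i : 'I_n].

Definition koszul n (d : 'I_n -> int) (sigma : 'S_n) : K :=
  \prod_(i < n) \prod_(j < n | (i < j)%N && (sigma j < sigma i)%N)
    (-1) ^ (d (sigma i) * d (sigma j)).

(* (i, n - i)-shuffles                                                        *)
Definition shuffle n (i : nat) (sigma : 'S_n) : bool :=
  [forall j : 'I_n, forall k : 'I_n,
    [&& (j < k)%N & (k < i)%N || (i <= j)%N] ==> (sigma j < sigma k)%N].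

(* l_k is the restriction of l to words of length k; the value of l on the
   empty word is irrelevant, since k >= 1.                                    *)
Record Linfty (l : seq V -> V) : Prop := LInfty {
  Linfty_vect : graded_vect;
  Linfty_multilinear : multilinear l;
  Linfty_deg : forall n (d : 'I_n -> int) (x : 'I_n -> V), (0 < n)%N ->
    (forall i, h (d i) (x i)) ->
    h (\sum_(i < n) d i + 1) (l [seq x i | i : 'I_n]);
  Linfty_sym : forall n (d : 'I_n -> int) (x : 'I_n -> V) (sigma : 'S_n),
    (0 < n)%N -> (forall i, h (d i) (x i)) ->
    l (perm_word x sigma) = koszul d sigma *: l [seq x i | i : 'I_n];
  Linfty_jacobi : forall n (d : 'I_n -> int) (x : 'I_n -> V),
    (0 < n)%N -> (forall i, h (d i) (x i)) ->
    \sum_(1 <= i < n.+1) \sum_(sigma : 'S_n | shuffle i sigma)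
      koszul d sigma *:
        l (l (take i (perm_word x sigma)) :: drop i (perm_word x sigma)) = 0 }.

(* The sum over k >= 1 is 0 in the sense that its partial sums are eventually
   0; no topology is involved.                                                *)
Definition maurer_cartan (l : seq V -> V) (x : V) :=
  h 0 x /\ exists N : nat, forall n : nat, (N <= n)%N ->
    \sum_(1 <= k < n.+1) (k`!%:R : K)^-1 *: l (nseq k x) = 0.

End GradedStructures.

Section QuasiTwilled.
Variables (K : fieldType) (A A' : lmodType K).

Definition inA (x : A) : A * A' := (x, 0).
Definition inA' (u : A') : A * A' := (0, u).

Lemma inA_linear : linear inA.
Proof. by move=> a x y; congr pair; rewrite /= scaler0 addr0. Qed.
HB.instance Definition _ :=
  GRing.isLinear.Build K A (A * A')%type *:%R inA inA_linear.

Lemma inA'_linear : linear inA'.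
Proof. by move=> a x y; congr pair; rewrite /= scaler0 addr0. Qed.
HB.instance Definition _ :=
  GRing.isLinear.Build K A' (A * A')%type *:%R inA' inA'_linear.

Record quasi_twilled := QuasiTwilled {
  Omega : {bilinear (A * A')%type -> (A * A')%type -> (A * A')%type};
  Omega_assoc : associative Omega;
  Omega_subalg : forall u v : A', (Omega (inA' u) (inA' v)).1 = 0 }.

End QuasiTwilled.

Section Bicomp.
Variables (K : fieldType) (U U' V V' X X' : lmodType K).
Variables (r : {linear X' -> X}) (f : {bilinear U' -> V' -> X'}).
Variables (p : {linear U -> U'}) (q : {linear V -> V'}).
Definition bicomp (x : U) (y : V) : X := r (f (p x) (q y)).
Lemma bicomp_bilinear : bilinear_for *:%R *:%R bicomp.
Proof.
by split=> [y|x] a u v; rewrite /bicomp /= linearP ?linearPl ?linearPr linearP.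
Qed.
HB.instance Definition _ :=
  bilinear_isBilinear.Build K U V X *:%R *:%R bicomp bicomp_bilinear.
End Bicomp.

Section Components.
Variables (K : fieldType) (A A' : lmodType K) (Q : quasi_twilled A A').
Local Notation W := (A * A')%type.
Local Notation iA := (@inA K A A').
Local Notation iA' := (@inA' K A A').
Local Notation pA := (@fst A A').
Local Notation pA' := (@snd A A').

Definition qt_pi : {bilinear A -> A -> A} := bicomp pA (Omega Q) iA iA.
Definition qt_xi : {bilinear A -> A' -> A} := bicomp pA (Omega Q) iA iA'.
Definition qt_eta : {bilinear A' -> A -> A} := bicomp pA (Omega Q) iA' iA.
Definition qt_beta : {bilinear A' -> A' -> A'} := bicomp pA' (Omega Q) iA' iA'.
Definition qt_rho : {bilinear A -> A' -> A'} := bicomp pA' (Omega Q) iA iA'.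
Definition qt_mu : {bilinear A' -> A -> A'} := bicomp pA' (Omega Q) iA' iA.
Definition qt_theta : {bilinear A -> A -> A'} := bicomp pA' (Omega Q) iA iA.

Lemma OmegaE (x y : A) (u v : A') :
  Omega Q (x, u) (y, v) =
  (qt_pi x y + qt_xi x v + qt_eta u y,
   qt_beta u v + qt_rho x v + qt_mu u y + qt_theta x y).
Proof.
have E (z : A) (w : A') : (z, w) = iA z + iA' w.
  by congr pair; rewrite /= ?addr0 ?add0r.
have S := Omega_subalg Q u v.
rewrite (E x) (E y) linearDl !linearDr.
congr pair => /=; first by rewrite S addr0.
by rewrite [LHS]addrACA [LHS]addrC [X in X + _]addrC [X in _ + X]addrC
  addrA.
Qed.

(* Lifts to W = A (+) A', extending by zero on the other tensor components.   *)
Definition lift_pi : multimap W W := binary (bicomp iA qt_pi pA pA).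
Definition lift_xi : multimap W W := binary (bicomp iA qt_xi pA pA').
Definition lift_eta : multimap W W := binary (bicomp iA qt_eta pA' pA).
Definition lift_beta : multimap W W := binary (bicomp iA' qt_beta pA' pA').
Definition lift_rho : multimap W W := binary (bicomp iA' qt_rho pA pA').
Definition lift_mu : multimap W W := binary (bicomp iA' qt_mu pA' pA).
Definition lift_theta : multimap W W := binary (bicomp iA' qt_theta pA pA).

Definition left_deformation_map (B : A' -> A) :=
  forall u v : A',
    qt_pi (B u) (B v) + qt_xi (B u) v + qt_eta u (B v) =
    B (qt_beta u v + qt_rho (B u) v + qt_mu u (B v) + qt_theta (B u) (B v)).

End Components.

Section Projection.
Variables (K : fieldType) (A A' : lmodType K).
Local Notation W := (A * A')%type.

(* Embedding of the sum of the Hom(A'^{(x) n+1}, A) into that of the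
   Hom(W^{(x) n+1}, W), by zero on the tensor components other than A'...A'.  *)
Definition liftF (f : multimap A' A) : multimap W W :=
  mcomp (@inA K A A') f (@snd A A').

Definition compF (f : multimap W W) : multimap A' A :=
  mcomp (@fst A A') f (@inA' K A A').

Definition projF (f : multimap W W) : multimap W W := liftF (compF f).

End Projection.

(* Main.v *)
Require Import Defs.
From HB Require Import structures.
From mathcomp Require Import all_boot all_order all_algebra perm zify ring.
From mathcomp Require Import boolp classical_sets functions.

Set Implicit Arguments.
Unset Strict Implicit.
Unset Printing Implicit Defensive.

Import Order.TTheory GRing.Theory Num.Theory.
Local Open Scope ring_scope.

(** Write L for the multilinear maps on W = A (+) A' with the Gerstenhaber
    bracket, and Omega for the multiplication of W.

    The bracket is a graded Lie bracket because insertion of one map into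
    another is a graded pre-Lie product: in the associator of f, g, h the
    terms that insert h into the block of g cancel, and what remains inserts g
    and h into f at two disjoint places, which is symmetric in g and h up to
    the Koszul sign ([ins_prelie]).  Insertion is written as a recursion on the
    word of arguments, so that this is an induction on words instead of a
    rearrangement of double sums.

    A map in F reads its arguments only through A' and takes values in A, so
    that inserting one such map into another gives 0; and P f = 0 means that f
    maps words over A' into A', a condition preserved by insertion.  Hence
    [projF_V_data]: any D of degree 1 with P D = 0 and [D, D] = 0 completes a
    V-data.  For D = Omega the last two conditions say that A' is a subalgebra
    and that Omega is associative.

    The L-infinity structure is given by Voronov's higher derived brackets
    l(x1, ..., xk) = P [..[[D, x1], x2], .., xk] ([derived_bracket_Linfty]).
    Expanding [..[[D, D], x1], .., xn] = 0 by the Leibniz rule gives a signed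
    sum over the ways to split x1 ... xn into two subwords u and v, with terms
    [D_u, D_v], where D_u is the iterated bracket of D with the letters of u.
    Since F is abelian and ker P is a subalgebra, P [y, z] =
    P [P y, z] + P [y, P z]; exchanging u and v shows that the two resulting sums agree, and
    half of the total is the generalized Jacobi identity.

    To see which parts of Omega contribute to l_k, let E be the projection of
    W onto A, an element of degree 0 of L. By the Jacobi identity [E, .] is a
    derivation of L. It acts on a map with k inputs in A as 1 - k if the
    output is in A and as - k if the output is in A'. In characteristic 0 the
    eigenvalue 1 therefore characterizes F, and P kills all other eigenspaces.
    The summand xi + eta + beta of Omega has eigenvalue 0, pi + rho + mu has
    eigenvalue -1, theta has eigenvalue -2, and each bracket with an element
    of F adds 1; so in l_k only the part of eigenvalue 1 - k survives, and on
    it P is the identity.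

    Finally, bracketing with a linear map B : A' -> A, regarded as a
    square-zero endomorphism b of W, is explicit on products, and l_1(B) +
    l_2(B, B) / 2 + l_3(B, B, B) / 6 comes out as the difference of the two
    sides of the equation of a left deformation map ([maurer_cartan_sumE]). *)

(** * Linear combinations in a module *)

Section LinearCombinations.
Variables (K : fieldType) (V : lmodType K).

(** Formal linear combinations of the vectors listed in an environment. *)
Inductive lcomb : Type :=
  | LZero | LVar of nat | LAdd of lcomb & lcomb | LOpp of lcomb
  | LScale of K & lcomb.

Fixpoint lcomb_eval (env : seq V) (e : lcomb) : V :=
  match e with
  | LZero => 0
  | LVar n => nth 0 env n
  | LAdd e1 e2 => lcomb_eval env e1 + lcomb_eval env e2
  | LOpp e1 => - lcomb_eval env e1
  | LScale c e1 => c *: lcomb_eval env e1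
  end.

Fixpoint lcomb_coef (e : lcomb) (i : nat) : K :=
  match e with
  | LZero => 0
  | LVar n => if eqn n i then 1 else 0
  | LAdd e1 e2 => lcomb_coef e1 i + lcomb_coef e2 i
  | LOpp e1 => - lcomb_coef e1 i
  | LScale c e1 => c * lcomb_coef e1 i
  end.

Lemma lcomb_evalE env e :
  lcomb_eval env e = \sum_(i < size env) lcomb_coef e i *: nth 0 env i.
Proof.
elim: e => [|n|e1 IH1 e2 IH2|e1 IH1|c e1 IH1] /=.
- by rewrite big1 // => i _; rewrite scale0r.
- have [lt_n|le_n] := ltnP n (size env); last first.
    rewrite nth_default // big1 // => i _.
    by case: eqnP => [E|_]; [have := ltn_ord i; lia | rewrite scale0r].
  rewrite (bigD1 (Ordinal lt_n)) //= big1 => [|i].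
    by case: eqnP => // _; rewrite scale1r addr0.
  rewrite -val_eqE /=; case: eqnP => [-> /eqP//|_ _].
  by rewrite scale0r.
- by rewrite IH1 IH2 -big_split; apply: eq_bigr => i _; rewrite scalerDl.
- by rewrite IH1 -sumrN; apply: eq_bigr => i _; rewrite scaleNr.
by rewrite IH1 scaler_sumr; apply: eq_bigr => i _; rewrite scalerA.
Qed.

Fixpoint same_coefs (e1 e2 : lcomb) (n : nat) : Prop :=
  if n is n'.+1 then
    lcomb_coef e1 n' = lcomb_coef e2 n' /\ same_coefs e1 e2 n'
  else True.

Lemma lcomb_eq env e1 e2 :
  same_coefs e1 e2 (size env) -> lcomb_eval env e1 = lcomb_eval env e2.
Proof.
move=> H; rewrite !lcomb_evalE; apply: eq_bigr => i _; congr (_ *: _).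
elim: (size env) H i => [_ []//|n IH /= [En H] i].
have [lt_in|le_ni] := ltnP i n; first exact: (IH H (Ordinal lt_in)).
by have -> : nat_of_ord i = n by have := ltn_ord i; lia.
Qed.
End LinearCombinations.

Ltac lcomb_mem x env :=
  lazymatch env with
  | nil => constr:(false)
  | cons x _ => constr:(true)
  | cons _ ?env' => lcomb_mem x env'
  end.

Ltac lcomb_atoms e env :=
  lazymatch e with
  | (?a + ?b)%R => let env1 := lcomb_atoms a env in lcomb_atoms b env1
  | (- ?a)%R => lcomb_atoms a env
  | (_ *: ?a)%R => lcomb_atoms a env
  | (0)%R => env
  | _ => lazymatch lcomb_mem e env with
         | true => env
         | false => constr:(cons e env)
         end
  end.

Ltac lcomb_index x env :=
  lazymatch env with
  | cons x _ => constr:(O)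
  | cons _ ?env' => let n := lcomb_index x env' in constr:(S n)
  end.

Ltac lcomb_reify K e env :=
  lazymatch e with
  | (?a + ?b)%R =>
      let ea := lcomb_reify K a env in let eb := lcomb_reify K b env in
      constr:(@LAdd K ea eb)
  | (- ?a)%R => let ea := lcomb_reify K a env in constr:(@LOpp K ea)
  | (?c *: ?a)%R =>
      let ea := lcomb_reify K a env in constr:(@LScale K c ea)
  | (0)%R => constr:(@LZero K)
  | _ => let n := lcomb_index e env in constr:(@LVar K n)
  end.

(** [lmodule_eq K V] reduces an equation between linear combinations in the
    [K]-module [V] to the equations in [K] between the coefficients of the
    atoms. *)
Ltac lmodule_eq K V :=
  lazymatch goal with
  | |- ?x = ?y =>
      let env0 := lcomb_atoms x (@nil V) in
      let env := lcomb_atoms y env0 in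
      let ex := lcomb_reify K x env in
      let ey := lcomb_reify K y env in
      change (@lcomb_eval K V env ex = @lcomb_eval K V env ey);
      apply: lcomb_eq;
      cbn [same_coefs lcomb_coef size eqn];
      do ?split
  end.

(** * Insertion of multilinear maps *)

Section Insertion.
Variables (K : fieldType) (W V : lmodType K).
Implicit Types (g h : seq W -> W) (s t : seq W).

(** The pre-Lie product of phi with a map h of degree q: the sum over all
    positions in the word of phi with h inserted there.  The first position is
    split off and the others insert h into phi (x :: _), so that identities
    can be proved by induction on the word.  Positions with fewer than q + 1
    letters to their right contribute 0 when h is homogeneous and phi
    multilinear. *)
Fixpoint ins (q : nat) h (phi : seq W -> V) s : V :=
  if s is x :: s' then
    phi (h (take q.+1 s) :: drop q.+1 s)
    + (-1) ^+ q *: ins q h (fun t => phi (x :: t)) s'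
  else 0.

Definition of_size (X : lmodType K) (n : nat) (a : seq W -> X) :=
  forall t, size t != n -> a t = 0.

Lemma multilinear0 (X : lmodType K) (f : seq W -> X) s t :
  multilinear f -> f (s ++ 0 :: t) = 0.
Proof.
move=> fl; have := fl s t (-1) 0 0.
by rewrite scaler0 add0r scaleN1r addNr.
Qed.

Lemma multilinear_cons (X : lmodType K) (f : seq W -> X) x :
  multilinear f -> multilinear (fun t => f (x :: t)).
Proof. by move=> fl s t a y z; apply: (fl (x :: s)). Qed.

Lemma of_size_cons (X : lmodType K) (f : seq W -> X) n x :
  of_size n.+1 f -> of_size n (fun t => f (x :: t)).
Proof. by move=> fn t tn; apply: fn. Qed.

Lemma eq_ins q h (phi psi : seq W -> V) s :
  phi =1 psi -> ins q h phi s = ins q h psi s.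
Proof.
elim: s phi psi => //= x s IH phi psi E; rewrite E; congr (_ + _ *: _).
by apply: IH => t; rewrite E.
Qed.

Lemma ins_linear q h (phi psi : seq W -> V) a s :
  ins q h (fun t => a *: phi t + psi t) s = a *: ins q h phi s + ins q h psi s.
Proof.
elim: s phi psi => [|x s IH] phi psi /=; first by rewrite scaler0 addr0.
rewrite IH !scalerDr !scalerA addrACA; congr (_ + _ + _).
by rewrite mulrC.
Qed.

Lemma ins_linear_op q h h' (phi : seq W -> V) a s : multilinear phi ->
  ins q (fun t => a *: h t + h' t) phi s = a *: ins q h phi s + ins q h' phi s.
Proof.
elim: s phi => [|x s IH] phi fl /=; first by rewrite scaler0 addr0.
rewrite IH; last exact: multilinear_cons.
have := fl [::] (drop q s) a (h (x :: take q s)) (h' (x :: take q s)).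
move=> /= ->; rewrite !scalerDr !scalerA addrACA; congr (_ + _ + _).
by rewrite mulrC.
Qed.

Lemma ins_eq0 q h (phi : seq W -> V) s :
  (forall t, t <> [::] -> phi t = 0) -> ins q h phi s = 0.
Proof.
elim: s phi => //= x s IH phi phi0; rewrite phi0 // IH ?scaler0 ?addr0 //.
by move=> t _; rewrite phi0.
Qed.

Lemma ins_size q m h (phi : seq W -> V) :
  multilinear phi -> of_size q.+1 h -> of_size m.+1 phi ->
  of_size (m + q).+1 (ins q h phi).
Proof.
move=> phil hq phim s; elim: s m phi phil phim => //= x s IH m phi phil phim.
rewrite eqSS => Es; have [lt_sq|le_qs] := ltnP (size s) q.
  rewrite hq /=; last by rewrite eqSS size_take; case: ltnP; lia.
  rewrite (multilinear0 [::]) // add0r; case: m phim Es => [|m] phim Es.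
    by rewrite ins_eq0 ?scaler0 // => -[//|y t] _; rewrite phim.
  by rewrite (IH m) ?scaler0 //; [exact: multilinear_cons | exact: of_size_cons].
rewrite phim /= ?size_drop; last lia.
case: m phim Es => [|m] phim Es.
  by rewrite ins_eq0 ?scaler0 ?addr0 // => -[//|y t] _; rewrite phim.
by rewrite (IH m) ?scaler0 ?addr0 //;
  [exact: multilinear_cons | exact: of_size_cons].
Qed.

End Insertion.

Section PreLie.
Variables (K : fieldType) (W V : lmodType K).
Implicit Types (g h : seq W -> W) (s t : seq W).

(** Insertion is a graded derivation: an insertion into a product of a, of
    arity n, and of Phi, reading the letters after the first n, goes either
    into a or past it, and in the second case h crosses a block of n letters. *)
Lemma ins_prod n q h (a : seq W -> W) (Phi : W -> seq W -> V) s :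
  of_size n a -> (forall t, linear (Phi^~ t)) ->
  ins q h (fun t => Phi (a (take n t)) (drop n t)) s =
  Phi (ins q h a (take (n + q) s)) (drop (n + q) s)
  + (-1) ^+ (n * q) *: ins q h (Phi (a (take n s))) (drop n s).
Proof.
move=> + Phil; have Phi0 t : Phi 0 t = 0.
  by have := Phil t (-1) 0 0; rewrite scaler0 add0r scaleN1r addNr.
elim: n s a => [|n IH] s a an.
  rewrite mul0n scale1r take0 drop0 (@ins_eq0 _ _ _ q h a) ?Phi0 ?add0r.
    by apply: eq_ins => t; rewrite take0 drop0.
  by case=> // x t _; rewrite an.
case: s => [|x s] /=; first by rewrite scaler0 addr0 Phi0.
rewrite (IH s (fun t => a (x :: t))); last exact: of_size_cons.
rewrite -?[(n.+1 + q)%N]/((n + q).+1) /= scalerDr !scalerA addrA -exprD.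
rewrite -mulSn; congr (_ + _).
rewrite take_takel ?leq_addl // -take_drop drop_drop.
by rewrite addrC -Phil addrC.
Qed.

(** The associator (phi . g) . h - phi . (g . h) on a word x :: s.  The first
    two terms have one of the inserted blocks at the start of the word and the
    other one to its right; exchanging g and h exchanges them up to sign.  The
    last term is the associator for phi (x :: _). *)
Lemma ins_assoc_step m n g h (phi : seq W -> V) x s :
  multilinear phi -> of_size m.+1 g ->
  ins n h (ins m g phi) (x :: s) - ins (m + n) (ins n h g) phi (x :: s) =
  (-1) ^+ m *: ins m g (fun t => phi (h (x :: take n s) :: t)) (drop n s)
  + (-1) ^+ (n + m * n) *:
      ins n h (fun t => phi (g (x :: take m s) :: t)) (drop m s)
  + (-1) ^+ (m + n) *:
      (ins n h (ins m g (fun t => phi (x :: t))) s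
       - ins (m + n) (ins n h g) (fun t => phi (x :: t)) s).
Proof.
move=> phil gm; have Phil t : linear (fun w => phi (w :: t)).
  by move=> a y z; apply: (phil [::]).
have E := ins_prod n h s (of_size_cons x gm) Phil.
rewrite /= (@eq_ins _ _ _ n h _ (fun t =>
  (-1) ^+ m *: ins m g (fun u => phi (x :: u)) t +
   phi (g (x :: take m t) :: drop m t))); last by move=> t; rewrite addrC.
rewrite ins_linear E take_takel ?leq_addl // -take_drop drop_drop.
rewrite [in X in _ - (X + _)]addrC Phil.
rewrite !scalerDr !scalerA -!exprD [(n + m)%N]addnC scalerN.
set X1 := phi _; set X2 := _ *: phi _; set X3 := _ *: ins m _ _ _.
set X4 := _ *: ins n h (ins _ _ _) _; set X5 := _ *: ins n h _ _.
set X6 := _ *: _.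
apply/eqP; rewrite subr_eq.
by rewrite [eqbRHS](AC (2*2*3) (6*1*(3*(5*2))*(7*4)))%AC /= addrN addr0.
Qed.

(** By [ins_assoc_step] and induction on the word: exchanging g and h matches
    the terms that insert g and h at disjoint places. *)
Lemma ins_prelie m n g h (phi : seq W -> V) s :
  multilinear phi -> of_size m.+1 g -> of_size n.+1 h ->
  ins n h (ins m g phi) s - ins (m + n) (ins n h g) phi s =
  (-1) ^+ (m * n) *:
    (ins m g (ins n h phi) s - ins (m + n) (ins m g h) phi s).
Proof.
move=> + gm hn; elim: s phi => [|x s IH] phi phil.
  by rewrite /= subrr scaler0.
have E := @ins_assoc_step n m h g _ x s phil hn.
rewrite [(n + m)%N]addnC in E; rewrite ins_assoc_step // {}E.
rewrite IH; last exact: multilinear_cons.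
move: (_ - _) => D; rewrite !(scalerDr, scalerA) -!exprD.
rewrite [X in X + _ = _]addrC; congr (_ *: _ + _ *: _ + _ *: _);
  rewrite -[LHS]signr_odd -[RHS]signr_odd !oddD !oddM;
  by case: (odd m); case: (odd n).
Qed.
End PreLie.

(** * The Gerstenhaber bracket is a graded Lie bracket *)

Section GerstenhaberIns.
Variables (K : fieldType) (W : lmodType K).

Lemma multimap_multilinear (U V : lmodType K) (f : multimap U V) :
  multilinear f.
Proof. by have [] := multimapP f. Qed.

Lemma multimap_nil (U V : lmodType K) (f : multimap U V) : f [::] = 0.
Proof. by have [] := multimapP f. Qed.

Lemma multimap_ext (U V : lmodType K) (f g : multimap U V) :
  (forall s, f s = g s) -> f = g.
Proof. by move=> E; apply/val_inj/funext. Qed.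

Lemma multimapD (U V : lmodType K) (f g : multimap U V) s :
  (f + g) s = f s + g s.
Proof. by []. Qed.

Lemma multimapZ (U V : lmodType K) a (f : multimap U V) s :
  (a *: f) s = a *: f s.
Proof. by []. Qed.

Lemma multimapN (U V : lmodType K) (f : multimap U V) s : (- f) s = - f s.
Proof. by []. Qed.

Lemma multimap0 (U V : lmodType K) s : (0 : multimap U V) s = 0.
Proof. by []. Qed.

Lemma multimap_degP (U V : lmodType K) (n : nat) (f : multimap U V) :
  multimap_deg n%:Z f <-> of_size n.+1 f.
Proof.
split=> fn s; first by move=> ns; apply: fn; rewrite -PoszD eqz_nat addn1.
by rewrite -PoszD eqz_nat addn1; apply: fn.
Qed.

Implicit Types (f g h : multimap W W) (s t : seq W).

Lemma ins_sum q (h : seq W -> W) (phi : seq W -> W) s :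
  ins q h phi s = \sum_(i < size s) (-1) ^+ (i * q) *:
    phi (take i s ++ h (take q.+1 (drop i s)) :: drop (i + q.+1) s).
Proof.
elim: s phi => [|x s IH] phi; first by rewrite big_ord0.
rewrite big_ord_recl scale1r /= IH scaler_sumr; congr (_ + _).
by apply: eq_bigr => i _; rewrite scalerA -exprD.
Qed.

Lemma circ_at_ins m n f g s :
  of_size n.+1 g -> (size s).+1 = (m + n.+1)%N ->
  circ_at m n.+1 f g s = ins n g f s.
Proof.
move=> gn Es; have le_ms : (m <= size s)%N by lia.
rewrite ins_sum /circ_at /= (big_ord_widen _ (fun i => (-1) ^+ (i * n) *:
  f (take i s ++ g (take n.+1 (drop i s)) :: drop (i + n.+1) s)) le_ms).
rewrite big_mkcond; apply: eq_bigr => i _; case: ltnP => // le_mi.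
rewrite gn ?(multilinear0 _ _ (@multimap_multilinear _ _ f)) ?scaler0 //.
by rewrite size_take size_drop; case: ltnP; lia.
Qed.

Lemma circ_at_eq0 p q f g s :
  (size s).+1 = (p + q)%N -> (0 < q)%N ->
  (forall t, size t = p -> f t = 0) \/ (forall t, size t = q -> g t = 0) ->
  circ_at p q f g s = 0.
Proof.
move=> Es q0 H; rewrite /circ_at big1 // => i _; have lt_ip := ltn_ord i.
case: H => [f0|g0].
  rewrite f0 ?scaler0 // size_cat /= size_drop size_take.
  by case: ltnP; lia.
rewrite g0 ?(multilinear0 _ _ (@multimap_multilinear _ _ f)) ?scaler0 //.
by rewrite size_take size_drop; case: ltnP; lia.
Qed.

(** On words of any length: if the length is not m + n + 1, all terms vanish. *)
Lemma gerstenhaber_ins m n f g s :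
  of_size m.+1 f -> of_size n.+1 g ->
  gerstenhaber f g s = ins n g f s - (-1) ^+ (m * n) *: ins m f g s.
Proof.
move=> fm gn; have [Es|Es] := eqVneq (size s) (m + n).+1.
  have [/multimap_degP fm' /multimap_degP gn'] := (fm, gn).
  by rewrite (gerstenhaber_homog fm' gn') // !circ_at_ins //; lia.
have [fl gl] := (@multimap_multilinear _ _ f, @multimap_multilinear _ _ g).
rewrite [in RHS](ins_size fl gn fm) // (ins_size gl fm gn) //; last lia.
rewrite scaler0 subrr /= /gerstenhaber_fun big1 // => k _.
have lt_ks := ltn_ord k.
rewrite !circ_at_eq0 ?scaler0 ?subrr //; try lia;
  have [Ek|Ek] := eqVneq (k : nat) m;
  by [right => t Et; rewrite ?fm ?gn //; lia
     |left => t Et; rewrite ?fm ?gn //; lia].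
Qed.

Lemma gerstenhaber_size m n f g :
  of_size m.+1 f -> of_size n.+1 g -> of_size (m + n).+1 (gerstenhaber f g).
Proof.
move=> fm gn s Es; rewrite (gerstenhaber_ins _ fm gn).
have [fl gl] := (@multimap_multilinear _ _ f, @multimap_multilinear _ _ g).
rewrite (ins_size fl gn fm) // (ins_size gl fm gn) ?scaler0 ?subrr //.
by rewrite addnC.
Qed.

Lemma circ_at_linearl p q (f1 f2 g : multimap W W) a s :
  circ_at p q (a *: f1 + f2) g s =
  a *: circ_at p q f1 g s + circ_at p q f2 g s.
Proof.
rewrite /circ_at scaler_sumr -big_split /=; apply: eq_bigr => i _.
by rewrite [in LHS]scalerDr !scalerA [_ * a]mulrC.
Qed.

Lemma circ_at_linearr p q (f g1 g2 : multimap W W) a s :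
  circ_at p q f (a *: g1 + g2) s =
  a *: circ_at p q f g1 s + circ_at p q f g2 s.
Proof.
rewrite /circ_at scaler_sumr -big_split /=; apply: eq_bigr => i _.
rewrite (@multimap_multilinear _ _ f).
by rewrite scalerDr !scalerA [_ * a]mulrC.
Qed.

Lemma gerstenhaber_bilinear :
  bilinear_for *:%R *:%R (@gerstenhaber K W).
Proof.
split=> [g|f] a f1 f2; apply: multimap_ext => s;
  rewrite multimapD multimapZ /= /gerstenhaber_fun scaler_sumr -big_split /=;
  apply: eq_bigr => k _; rewrite circ_at_linearl circ_at_linearr;
  by rewrite scalerBr !scalerDr opprD addrACA !scalerA [_ * a]mulrC.
Qed.

End GerstenhaberIns.

(** Signs as conditionals on parities: case analysis on the parities then
    proves any sign identity. *)
Lemma signr_if (R : pzRingType) n : (-1 : R) ^+ n = if odd n then -1 else 1.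
Proof. by rewrite -signr_odd; case: odd. Qed.

Lemma signz_if (R : unitRingType) (z : int) :
  (-1 : R) ^ z = if odd `|z|%N then -1 else 1.
Proof.
rewrite -signr_if; case: z => n //.
by rewrite -[LHS]/((-1) ^- n.+1) invr_sign.
Qed.

Lemma odd_abszD (x y : int) : odd `|(x + y)%R|%N = odd `|x|%N (+) odd `|y|%N.
Proof. lia. Qed.

Lemma odd_abszM (x y : int) : odd `|(x * y)%R|%N = odd `|x|%N && odd `|y|%N.
Proof. by rewrite abszM oddM. Qed.

Section GerstenhaberLie.
Variables (K : fieldType) (W : lmodType K).
Implicit Types (f g h : multimap W W).

Lemma multimap_deg_neg (U V : lmodType K) (n : nat) (f : multimap U V) :
  multimap_deg (Negz n) f -> f = 0.
Proof.
move=> fi; apply: multimap_ext => s; rewrite multimap0.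
have [->|/eqP Es] := eqVneq s [::]; first exact: multimap_nil.
by apply: fi; case: s Es => // x s _; case: n.
Qed.

Lemma multimap_deg_cases (U V : lmodType K) (i : int) (f : multimap U V) :
  multimap_deg i f -> f = 0 \/ exists2 n : nat, i = n%:Z & of_size n.+1 f.
Proof.
case: i => n fi; last by left; apply: multimap_deg_neg fi.
by right; exists n => //; apply/multimap_degP.
Qed.

Lemma gerstenhaber_antisym m n f g :
  of_size m.+1 f -> of_size n.+1 g ->
  gerstenhaber f g = - ((-1) ^+ (m * n) *: gerstenhaber g f).
Proof.
move=> fm gn; apply: multimap_ext => s; rewrite multimapN multimapZ.
rewrite (gerstenhaber_ins _ fm gn) (gerstenhaber_ins _ gn fm) [(n * m)%N]mulnC.
by rewrite signr_if; case: odd; lmodule_eq K W; ring.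
Qed.

(** Expanding both sides into twelve double insertions, the difference is the
    signed sum of the pre-Lie identities based at f, at g and at h. *)
Lemma gerstenhaber_jacobi m n p f g h :
  of_size m.+1 f -> of_size n.+1 g -> of_size p.+1 h ->
  gerstenhaber f (gerstenhaber g h) =
  gerstenhaber (gerstenhaber f g) h
  + (-1) ^+ (m * n) *: gerstenhaber g (gerstenhaber f h).
Proof.
move=> fm gn hp; apply: multimap_ext => s; rewrite multimapD multimapZ.
have [[fl gl] hl] := (@multimap_multilinear _ _ _ f,
  @multimap_multilinear _ _ _ g, @multimap_multilinear _ _ _ h).
have B j k (b c : multimap W W) : of_size j.+1 b -> of_size k.+1 c ->
    (gerstenhaber b c : seq W -> W) =
    (fun t => (- (-1) ^+ (j * k)) *: ins j b c t + ins k c b t).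
  move=> bj ck; apply: funext => t.
  by rewrite (gerstenhaber_ins _ bj ck) scaleNr addrC.
have El i j k (a b c : multimap W W) : of_size i.+1 a -> of_size j.+1 b ->
    of_size k.+1 c -> gerstenhaber a (gerstenhaber b c) s =
   ins (j + k) (ins k c b) a s - (-1) ^+ (j * k) *: ins (j + k) (ins j b c) a s
   - (-1) ^+ (i * (j + k)) *: (ins i a (ins k c b) s
     - (-1) ^+ (j * k) *: ins i a (ins j b c) s).
  move=> ai bj ck.
  rewrite (gerstenhaber_ins _ ai (gerstenhaber_size bj ck)) (B _ _ _ _ bj ck).
  rewrite ins_linear ins_linear_op; last exact: multimap_multilinear.
  by lmodule_eq K W; ring.
have Er i j k (a b c : multimap W W) : of_size i.+1 a -> of_size j.+1 b ->
    of_size k.+1 c -> gerstenhaber (gerstenhaber a b) c s =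
   ins k c (ins j b a) s - (-1) ^+ (i * j) *: ins k c (ins i a b) s
   - (-1) ^+ ((i + j) * k) *: (ins (i + j) (ins j b a) c s
     - (-1) ^+ (i * j) *: ins (i + j) (ins i a b) c s).
  move=> ai bj ck.
  rewrite (gerstenhaber_ins _ (gerstenhaber_size ai bj) ck) (B _ _ _ _ ai bj).
  rewrite ins_linear ins_linear_op; last exact: multimap_multilinear.
  by lmodule_eq K W; ring.
rewrite (El m n p) // (El n m p) // (Er m n p) //.
have Pf := ins_prelie s fl gn hp; have Pg := ins_prelie s gl fm hp.
have Ph := ins_prelie s hl fm gn.
move/eqP: Pf; rewrite subr_eq => /eqP ->.
move/eqP: Pg; rewrite subr_eq => /eqP ->.
move/eqP: Ph; rewrite subr_eq => /eqP ->.
rewrite !signr_if !(oddM, oddD).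
by case: (odd m); case: (odd n); case: (odd p); cbn; lmodule_eq K W; ring.
Qed.
End GerstenhaberLie.

Section MultimapGrading.
Variables (K : fieldType) (U V : lmodType K).
Implicit Types (f g : multimap U V) (i : int).
Local Notation deg := (@multimap_deg K U V).

Lemma component_subproof i f :
  multimap_axiom (fun s => if (size s)%:Z == i + 1 then f s else 0).
Proof.
have [f0 fl [N fN]] := multimapP f; split=> [|s t a x y|].
- by rewrite f0 if_same.
- rewrite !size_cat /=; case: ifP => _; first exact: fl.
  by rewrite scaler0 addr0.
by exists N => s sN; rewrite fN ?if_same.
Qed.
Definition component i f : multimap U V := mk_multimap (component_subproof i f).

Lemma component_deg i f : deg i (component i f).
Proof. by move=> s /negbTE /= ->. Qed.

Lemma multimap_deg_subspace i : subspace (deg i).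
Proof.
split=> [s _|a f g fi gi s Es]; first by rewrite multimap0.
by rewrite multimapD multimapZ fi // gi // scaler0 addr0.
Qed.

Lemma multimap_sumE (I : Type) (r : seq I) (F : I -> multimap U V) s :
  (\sum_(i <- r) F i) s = \sum_(i <- r) F i s.
Proof.
elim: r => [|i r IH]; rewrite ?big_nil ?multimap0 // !big_cons.
by rewrite multimapD IH.
Qed.

Lemma component_sum f : exists2 r : seq int,
  uniq r & f = \sum_(i <- r) component i f.
Proof.
have [f0 fl [N fN]] := multimapP f.
exists [seq Posz n | n <- iota 0 N].
  by rewrite map_inj_uniq ?iota_uniq // => m n [].
apply: multimap_ext => s; rewrite multimap_sumE big_map /=.
have [le_Ns|lt_sN] := leqP N (size s).
  by rewrite fN // big1 // => i _; rewrite if_same.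
case: s lt_sN => [|x s] lt_sN.
  by rewrite f0 big1 // => i _; rewrite if_same.
have ins : size s \in iota 0 N by rewrite mem_iota; apply: ltnW.
rewrite (bigD1_seq (size s)) ?iota_uniq //=.
rewrite -PoszD addn1 eqxx big1 ?addr0 // => n /negbTE ns.
by rewrite -PoszD addn1 eqz_nat eqSS eq_sym ns.
Qed.

Lemma multimap_graded_subspace (S : set (multimap U V)) :
  subspace S -> (forall i f, S f -> S (component i f)) -> graded_subspace deg S.
Proof.
move=> Ss Sc; split=> // f Sf; have [r ur Ef] := component_sum f.
exists r, (component^~ f); split=> // i; first exact: component_deg.
exact: Sc.
Qed.

Lemma multimap_graded_vect : graded_vect deg.
Proof.
split=> [i||r c ur ci c0 i ir]; first exact: multimap_deg_subspace.
  by apply: multimap_graded_subspace.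
apply: multimap_ext => s; rewrite multimap0.
have [Es|Es] := eqVneq (size s : int) (i + 1); last exact: ci.
have /(congr1 (fun f : multimap U V => f s)) := c0.
rewrite multimap_sumE (bigD1_seq i) //= big1 ?addr0 // => j /eqP ji.
by apply: ci; rewrite Es; apply/eqP => /addIr /esym.
Qed.

(** Additive statements about all maps, which may have components of several
    arities, need only be proved for homogeneous maps. *)
Lemma multimap_homogeneous_ind (P : multimap U V -> Prop) :
  P 0 -> (forall f g, P f -> P g -> P (f + g)) ->
  (forall n f, of_size n.+1 f -> P f) -> forall f, P f.
Proof.
move=> P0 PD Ph f; have [r _ ->] := component_sum f.
elim: r => [|i r IH]; rewrite ?big_nil // big_cons; apply: PD => //.
case: (multimap_deg_cases (@component_deg i f)) => [->//|[n _]].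
exact: Ph.
Qed.
End MultimapGrading.

Section GerstenhaberGradedLie.
Variables (K : fieldType) (W : lmodType K).
Implicit Types (f g h : multimap W W).
Local Notation br := (@gerstenhaber K W).

HB.instance Definition _ := bilinear_isBilinear.Build K _ _ _ *:%R *:%R
  br (gerstenhaber_bilinear W).

Lemma gerstenhaber_graded_Lie :
  graded_Lie (@multimap_deg K W W) br.
Proof.
split.
- exact: multimap_graded_vect.
- exact: gerstenhaber_bilinear.
- move=> i j f g; case/multimap_deg_cases => [-> _|[m -> fm]].
    rewrite linear0l; exact: (multimap_deg_subspace _ _ _).1.
  case/multimap_deg_cases => [->|[n -> gn]].
    rewrite linear0r; exact: (multimap_deg_subspace _ _ _).1.
  by rewrite -PoszD; apply/multimap_degP/gerstenhaber_size.
- move=> i j f g; case/multimap_deg_cases => [-> _|[m -> fm]].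
    by rewrite linear0l linear0r scaler0 oppr0.
  case/multimap_deg_cases => [->|[n -> gn]].
    by rewrite linear0l linear0r scaler0 oppr0.
  by rewrite -PoszM; apply: gerstenhaber_antisym.
- move=> i j k f g h; case/multimap_deg_cases => [-> _ _|[m -> fm]].
    by rewrite !linear0l linear0r scaler0 addr0.
  case/multimap_deg_cases => [-> _|[n -> gn]].
    by rewrite !(linear0l, linear0r) scaler0 addr0.
  case/multimap_deg_cases => [->|[p _ hp]].
    by rewrite !(linear0l, linear0r) scaler0 addr0.
  by rewrite -PoszM; apply: gerstenhaber_jacobi fm gn hp.
Qed.
End GerstenhaberGradedLie.

(** * Shuffles and Koszul signs *)

(** The splittings of a word into two complementary subwords, enumerated by
    the fate of the first letter, as in the Leibniz rule. *)
Fixpoint unshuffles (T : Type) (w : seq T) : seq (seq T * seq T) :=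
  if w is x :: w' then
    [seq (x :: p.1, p.2) | p <- unshuffles w']
    ++ [seq (p.1, x :: p.2) | p <- unshuffles w']
  else [:: ([::], [::])].

Lemma unshuffles_perm (T : eqType) (w : seq T) p :
  p \in unshuffles w -> perm_eq (p.1 ++ p.2) w.
Proof.
elim: w p => [|x w IH] p /=; first by rewrite inE => /eqP ->.
rewrite mem_cat => /orP[] /mapP[q /IH qw ->] /=; first by rewrite perm_cons.
by rewrite perm_catC /= perm_cons perm_catC.
Qed.

Lemma unshuffles_uniq (T : eqType) (w : seq T) : uniq w -> uniq (unshuffles w).
Proof.
elim: w => //= x w IH /andP[xw /IH uw]; rewrite cat_uniq.
rewrite !map_inj_uniq ?uw /= ?andbT; first last.
- by move=> [a b] [a' b'] /= [-> ->].
- by move=> [a b] [a' b'] /= [-> ->].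
apply/hasPn => _ /mapP[p /unshuffles_perm pw ->].
apply: contra xw => /mapP[q _ [p1 _]].
by rewrite -(perm_mem pw) mem_cat p1 mem_head.
Qed.

Lemma unshuffles_swap (T : eqType) (w : seq T) :
  perm_eq [seq (p.2, p.1) | p <- unshuffles w] (unshuffles w).
Proof.
elim: w => //= x w IH; rewrite map_cat -!map_comp perm_catC.
by apply: perm_cat;
  rewrite (perm_trans _ (perm_map _ IH)) // -map_comp.
Qed.

Section Words.
Variable n : nat.
Implicit Types (u v w : seq 'I_n) (sigma : 'S_n).

Definition lt_ord : rel 'I_n := fun a b => (a < b)%N.
Local Notation increasing := (pairwise lt_ord).

Lemma enum_increasing : increasing (enum 'I_n).
Proof.
have -> : lt_ord = relpre val ltn by [].
rewrite -pairwise_map val_enum_ord -sorted_pairwise ?iota_ltn_sorted //.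
exact: ltn_trans.
Qed.

Lemma mem_unshuffles w u v : increasing w ->
  ((u, v) \in unshuffles w) =
  [&& increasing u, increasing v & perm_eq (u ++ v) w].
Proof.
elim: w u v => [|a w IH] u v /=.
  move=> _; apply/idP/and3P => [|[_ _ /perm_nilP]].
    by rewrite inE => /eqP[-> ->].
  by case: u => //= ->; rewrite inE.
case/andP=> aw iw; apply/idP/and3P.
  have sub u' v' : (u', v') \in unshuffles w ->
      [/\ all (lt_ord a) u' && increasing u', all (lt_ord a) v' && increasing v'
        & perm_eq (u' ++ v') w].
    rewrite IH // => /and3P[-> -> p]; rewrite !andbT; split=> //;
    by apply/allP => b bu; apply: (allP aw);
      rewrite -(perm_mem p) mem_cat bu ?orbT.
  rewrite mem_cat => /orP[] /mapP[[u' v'] /sub[iu iv p] [-> ->]] /=.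
    by rewrite perm_cons; case/andP: iv.
  by rewrite perm_catC /= perm_cons perm_catC; case/andP: iu.
case=> iu iv p; rewrite mem_cat.
have ge_a b : b \in u ++ v -> b = a \/ (a < b)%N.
  rewrite (perm_mem p) inE => /predU1P[]; first by left.
  by move/(allP aw); right.
have : a \in u ++ v by rewrite (perm_mem p) mem_head.
have head_a c s : a \in c :: s -> increasing (c :: s) ->
    {subset c :: s <= u ++ v} -> c = a.
  move=> ac /= /andP[cs _] sub; case: (ge_a c (sub c (mem_head _ _))) => // lt_ac.
  move: ac; rewrite inE => /predU1P[//|/(allP cs)].
  by rewrite /lt_ord ltnNge ltnW.
rewrite mem_cat => /orP[au|av].
  case: u iu p head_a au {ge_a} => [//|c u] iu p head_a au; apply/orP; left.
  have Ec : c = a by apply: head_a au iu _ => b; rewrite mem_cat => ->.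
  rewrite {}Ec in iu p *; apply/mapP; exists (u, v) => //.
  by case/andP: iu => _ iu; rewrite IH //; apply/and3P; split; rewrite // -(perm_cons a).
case: v iv p head_a av {ge_a} => [//|c v] iv p head_a av; apply/orP; right.
have Ec : c = a by apply: head_a av iv _ => b; rewrite mem_cat => ->; rewrite orbT.
rewrite {}Ec in iv p *; apply/mapP; exists (u, v) => //.
case/andP: iv => _ iv; rewrite IH //; apply/and3P; split=> //.
rewrite -(perm_cons a); apply: perm_trans p.
by rewrite perm_sym -[a :: v]cat1s perm_catCA.
Qed.

Lemma increasing_lt (r : rel 'I_n) w a b :
  increasing w -> pairwise r w -> a \in w -> b \in w -> (a < b)%N -> r a b.
Proof.
elim: w => //= c w IH /andP[cw iw] /andP[rw pw].
rewrite !inE => /predU1P[->|aw] /predU1P[->|bw]; rewrite ?ltnn //.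
- by move=> _; apply: (allP rw).
- by move=> ac; have := allP cw a aw; rewrite /lt_ord ltnNge ltnW.
exact: IH.
Qed.

Lemma mem_take_enum i (j : 'I_n) : (j \in take i (enum 'I_n)) = (j < i)%N.
Proof. by rewrite in_take ?mem_enum // index_enum_ord. Qed.

Lemma mem_drop_enum i (j : 'I_n) : (j \in drop i (enum 'I_n)) = (i <= j)%N.
Proof.
have := enum_uniq 'I_n; rewrite -{1}(cat_take_drop i (enum 'I_n)) cat_uniq.
case/and3P=> _ /hasPn dis _; apply/idP/idP => [jd|le_ij].
  by rewrite leqNgt -mem_take_enum; apply: dis.
have := mem_enum 'I_n j; rewrite -{1}(cat_take_drop i (enum 'I_n)) mem_cat.
by rewrite mem_take_enum ltnNge le_ij.
Qed.

Lemma shuffleE i sigma (w := [seq sigma j | j <- enum 'I_n]) :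
  shuffle i sigma = increasing (take i w) && increasing (drop i w).
Proof.
rewrite /w -map_take -map_drop !pairwise_map.
have it : increasing (take i (enum 'I_n)).
  by apply: subseq_pairwise enum_increasing; apply: take_subseq.
have dr : increasing (drop i (enum 'I_n)).
  by apply: subseq_pairwise enum_increasing; apply: drop_subseq.
apply/forallP/andP => [H|[pt pd] j].
  have H' (j k : 'I_n) : (j < k)%N -> (k < i)%N || (i <= j)%N -> (sigma j < sigma k)%N.
    by move=> jk ki; have /forallP/(_ k) := H j; rewrite jk ki.
  split.
    apply: (sub_in_pairwise (P := mem (take i (enum 'I_n)))) (it) => //.
      move=> j k _ /=; rewrite mem_take_enum => ki jk.
      by apply: H'; rewrite ?ki.
  apply: (sub_in_pairwise (P := mem (drop i (enum 'I_n)))) (dr) => //.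
    move=> j k /=; rewrite mem_drop_enum => ij _ jk.
    by apply: H'; rewrite ?ij ?orbT.
apply/forallP => k; apply/implyP => /andP[jk /orP[ki|ij]].
  apply: (increasing_lt it pt) => //; rewrite mem_take_enum //.
  exact: ltn_trans ki.
apply: (increasing_lt dr pd) => //; rewrite mem_drop_enum //.
exact: leq_trans (ltnW jk).
Qed.

Lemma perm_map_enum sigma :
  perm_eq [seq sigma j | j <- enum 'I_n] (enum 'I_n).
Proof.
apply: uniq_perm; rewrite ?enum_uniq //.
  by rewrite map_inj_uniq ?enum_uniq //; apply: perm_inj.
move=> k; rewrite mem_enum; apply/mapP; exists (sigma^-1%g k).
  by rewrite mem_enum.
by rewrite permKV.
Qed.

(** Cutting the word of an (i, n - i)-shuffle after i letters is a bijection
    from the shuffles, for all i, to the splittings of 0 1 ... n-1. *)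
Lemma shuffles_unshuffles (V : nmodType) (Psi : seq 'I_n -> seq 'I_n -> V) :
  \sum_(0 <= i < n.+1) \sum_(sigma : 'S_n | shuffle i sigma)
     Psi (take i [seq sigma j | j <- enum 'I_n])
         (drop i [seq sigma j | j <- enum 'I_n])
  = \sum_(p <- unshuffles (enum 'I_n)) Psi p.1 p.2.
Proof.
pose word sigma := [seq sigma j | j <- enum 'I_n].
transitivity (\sum_(p <- [seq (take i (word sigma), drop i (word sigma))
    | i <- iota 0 n.+1, sigma <- enum (@shuffle n i)]) Psi p.1 p.2).
  rewrite big_allpairs_dep /index_iota subn0; apply: eq_bigr => i _.
  by rewrite big_enum.
have szw sigma : size (word sigma) = n by rewrite size_map size_enum_ord.
apply: perm_big; apply: uniq_perm.
- apply: allpairs_uniq_dep; first exact: iota_uniq.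
    by move=> i _; apply: enum_uniq.
  move=> [i s] [j t] /allpairsPdep[i' [s' [ii _ [Ei _]]]].
  case/allpairsPdep=> [j' [t' [jj _ [Ej _]]]] /= [E1 E2].
  have /= Eij : i = j.
    have := congr1 size E1; rewrite !size_takel ?szw //.
      by move: jj; rewrite mem_iota Ej.
    by move: ii; rewrite mem_iota Ei.
  case: _ / Eij E1 E2 {Ej} => E1 E2; congr Tagged.
  have E : word s = word t.
    by rewrite -(cat_take_drop i (word s)) E1 E2 cat_take_drop.
  by apply/permP => k; apply: (eq_in_map _ _ _).2 E _ _; rewrite mem_enum.
- exact/unshuffles_uniq/enum_uniq.
move=> [u v]; rewrite mem_unshuffles ?enum_increasing //.
apply/allpairsPdep/and3P => [[i [s [_ + [-> ->]]]]|[iu iv p]].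
  rewrite mem_enum -topredE /= shuffleE => /andP[-> ->]; split=> //.
  by rewrite cat_take_drop perm_map_enum.
have szuv : size (u ++ v) == n by rewrite (perm_size p) size_enum_ord.
have /tuple_uniqP inj : uniq (Tuple szuv) by rewrite (perm_uniq p) enum_uniq.
have Ew : word (perm inj) = u ++ v.
  rewrite -[RHS]/(tval (Tuple szuv)) -[in RHS]map_tnth_enum.
  by apply: eq_map => j; rewrite permE.
exists (size u), (perm inj); rewrite -/(word _) Ew.
rewrite take_size_cat // drop_size_cat //; split=> //.
  rewrite mem_iota add0n ltnS; apply: leq_trans (leq_addr (size v) _) _.
  by rewrite -size_cat (eqP szuv).
rewrite mem_enum -topredE /= shuffleE -/(word _) Ew.
by rewrite take_size_cat // drop_size_cat // iu iv.
Qed.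

Variables (K : fieldType) (d : 'I_n -> int).

(** The Koszul sign of sorting a word, one letter at a time, so that it can be
    followed along splittings and iterated brackets. *)
Fixpoint inv_sign w : K :=
  if w is a :: w' then
    (\prod_(b <- w' | (b < a)%N) (-1) ^ (d a * d b)) * inv_sign w'
  else 1.

End Words.

Lemma koszul_inv_sign (K : fieldType) n (d : 'I_n -> int) (sigma : 'S_n) :
  koszul K d sigma = inv_sign K d [seq sigma i | i <- enum 'I_n].
Proof.
rewrite /koszul; set f := fun_of_perm sigma; move: f => f.
suff E k (h : 'I_k -> 'I_n) :
  \prod_(i < k) \prod_(j < k | (i < j)%N && (h j < h i)%N)
    (-1) ^ (d (h i) * d (h j)) = inv_sign K d [seq h i | i <- enum 'I_k].
  exact: E.
elim: k h => [|k IH] h.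
  by rewrite big_ord0 enum_ord0.
rewrite big_ord_recl enum_ordSl /= -map_comp -(IH (h \o lift ord0)).
congr (_ * _).
  rewrite big_mkcond big_ord_recl /= mul1r big_map -big_mkcond big_enum_cond.
  done.
apply: eq_bigr => i _; rewrite big_mkcond big_ord_recl /= mul1r -big_mkcond.
done.
Qed.

Lemma inv_sign_cons (K : fieldType) n (d : 'I_n -> int) a w :
  inv_sign K d (a :: w) =
  \prod_(b <- w | (b < a)%N) (-1) ^ (d a * d b) * inv_sign K d w.
Proof. by []. Qed.
Arguments inv_sign : simpl never.
Section InversionSigns.
Variables (K : fieldType) (n : nat) (d : 'I_n -> int).
Implicit Types (u v w : seq 'I_n).
Local Notation inv := (inv_sign K d).
Local Notation increasing := (pairwise (@lt_ord n)).

Definition word_deg w : int := \sum_(a <- w) d a.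

Lemma word_deg_cons a w : word_deg (a :: w) = d a + word_deg w.
Proof. by rewrite /word_deg big_cons. Qed.

Lemma signzD (x y : int) : (-1 : K) ^ (x + y) = (-1) ^ x * (-1) ^ y.
Proof. by rewrite expfzDr // oppr_eq0 oner_eq0. Qed.

Lemma signzM_prod a w :
  \prod_(b <- w) (-1) ^ (d a * d b) = (-1 : K) ^ (d a * word_deg w).
Proof.
elim: w => [|b w IH]; first by rewrite /word_deg !big_nil mulr0.
by rewrite big_cons IH word_deg_cons mulrDr signzD.
Qed.

Lemma inv_sign_min a w : all (lt_ord a) w -> inv (a :: w) = inv w.
Proof.
move=> aw; rewrite inv_sign_cons big_seq_cond big_pred0 ?mul1r // => b.
apply/andP => -[/(allP aw)]; rewrite /lt_ord => ab.
by rewrite ltnNge ltnW.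
Qed.

(** A letter smaller than all others has to cross exactly the letters on its
    left. *)
Lemma inv_sign_mid u a v : all (lt_ord a) u -> all (lt_ord a) v ->
  inv (u ++ a :: v) = (-1) ^ (d a * word_deg u) * inv (u ++ v).
Proof.
move=> au av; elim: u au => [_|b u IH /andP[ab au]].
  by rewrite inv_sign_min // /word_deg big_nil mulr0 mul1r.
rewrite /= !inv_sign_cons IH // word_deg_cons mulrDr signzD !big_cat big_cons /=.
by move: ab; rewrite /lt_ord => ->; rewrite [d b * d a]mulrC; ring.
Qed.

Lemma unshuffles_all (P : pred 'I_n) w p :
  p \in unshuffles w -> all P w -> all P p.1 && all P p.2.
Proof. by move/unshuffles_perm/perm_all => <-; rewrite all_cat. Qed.

Lemma inv_sign_swap w p : increasing w -> p \in unshuffles w ->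
  inv (p.2 ++ p.1) =
  (-1) ^ (word_deg p.1 * word_deg p.2) * inv (p.1 ++ p.2).
Proof.
elim: w p => [|a w IH] p /=.
  by move=> _; rewrite inE => /eqP -> /=; rewrite /word_deg big_nil mul1r.
case/andP=> aw iw; rewrite mem_cat => /orP[] /mapP[q qw ->] /=;
  have /andP[a1 a2] := unshuffles_all qw aw; have {}IH := IH q iw qw.
  rewrite inv_sign_mid // (@inv_sign_min a (q.1 ++ q.2)) ?all_cat ?a1 //.
  by rewrite IH word_deg_cons mulrDl signzD mulrA.
rewrite inv_sign_mid // (@inv_sign_min a (q.2 ++ q.1)) ?all_cat ?a1 ?a2 //.
rewrite IH word_deg_cons mulrDr signzD [d a * _]mulrC.
rewrite !signz_if; case: odd; case: odd; ring.
Qed.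
End InversionSigns.

(** * Higher derived brackets *)

Section HigherDerivedBrackets.
Variables (K : fieldType) (L : lmodType K) (h : int -> set L).
Variables (br : L -> L -> L) (F : set L) (P : L -> L) (D : L).
Hypothesis HV : V_data h br F P D.

(** F is presented as the image of an embedding j of a graded space L', with
    retraction c, because the brackets are operations on L'. *)
Variables (L' : lmodType K) (h' : int -> set L').
Variables (j : {linear L' -> L}) (c : {linear L -> L'}).
Hypothesis jK : cancel j c.
Hypothesis Pjc : forall x, P x = j (c x).
Hypothesis j_deg : forall i x, h' i x -> h i (j x).
Hypothesis c_deg : forall i x, h i x -> h' i (c x).
Hypothesis two_neq0 : (2%:R : K) != 0.

Definition nested (p : L) (s : seq L') : L := foldl br p (map j s).
Definition derived_bracket (s : seq L') : L' := c (nested D s).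
Local Notation l := derived_bracket.

Let HL := V_data_Lie HV.

Lemma br_linearr x : linear (br x).
Proof. by case: (graded_Lie_bilinear HL) => _; apply. Qed.

HB.instance Definition _ := bilinear_isBilinear.Build K L L L *:%R *:%R
  br (graded_Lie_bilinear HL).

Lemma nested_linear s : linear (nested^~ s).
Proof.
rewrite /nested; elim: s => //= y s IH a x z.
by rewrite linearPl IH.
Qed.
Lemma nestedD s x y : nested (x + y) s = nested x s + nested y s.
Proof. by have := nested_linear s 1 x y; rewrite !scale1r. Qed.
Lemma nested0 s : nested 0 s = 0.
Proof. by apply/(addrI (nested 0 s)); rewrite -nestedD !addr0. Qed.
Lemma nestedZ s a x : nested (a *: x) s = a *: nested x s.
Proof. by have := nested_linear s a x 0; rewrite nested0 !addr0. Qed.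

Lemma nested_cat p s t : nested p (s ++ t) = nested (nested p s) t.
Proof. by rewrite /nested map_cat foldl_cat. Qed.

Lemma nested_cons p y s : nested p (y :: s) = nested (br p (j y)) s.
Proof. by []. Qed.

Lemma range_j x : F (j x).
Proof. by rewrite -(V_data_image HV); exists (j x); rewrite // Pjc jK. Qed.

Lemma br_j x y : br (j x) (j y) = 0.
Proof. by apply: (V_data_abelian HV); apply: range_j. Qed.

(** F is abelian, so the Jacobi identity for p, y, z has only two terms. *)
Lemma br_swap q a b p y z : h q p -> h' a y -> h' b z ->
  br (br p (j y)) (j z) = (-1) ^ (a * b) *: br (br p (j z)) (j y).
Proof.
move=> pq /j_deg ya /j_deg zb.
have := graded_Lie_jacobi HL pq ya zb; rewrite br_j linear0r.
rewrite (graded_Lie_antisym HL ya (graded_Lie_deg HL pq zb)).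
move/esym/eqP; rewrite addr_eq0 => /eqP ->; rewrite scalerN opprK scalerA.
congr (_ *: _); rewrite !signz_if !(odd_abszD, odd_abszM).
by case: odd; case: odd; case: odd; cbn; ring.
Qed.

Lemma br_right_derivation q r a p x y : h q p -> h r x -> h a y ->
  br (br p x) y = br p (br x y) + (-1) ^ (r * a) *: br (br p y) x.
Proof.
move=> pq xr ya; rewrite (graded_Lie_jacobi HL pq xr ya).
rewrite (graded_Lie_antisym HL xr (graded_Lie_deg HL pq ya)).
rewrite !signz_if !(odd_abszD, odd_abszM).
by case: odd; case: odd; case: odd; cbn; lmodule_eq K L; ring.
Qed.

Variables (n : nat) (d : 'I_n -> int) (x : 'I_n -> L').
Hypothesis xd : forall i, h' (d i) (x i).
Local Notation inv := (inv_sign K d).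
Local Notation wd := (word_deg d).
Local Notation increasing := (pairwise (@lt_ord n)).
Local Notation nest p w := (nested p (map x w)).

Lemma nested_deg q p w : h q p -> h (q + wd w) (nest p w).
Proof.
elim: w q p => [|a w IH] q p pq.
  by rewrite /word_deg big_nil addr0.
rewrite /= nested_cons word_deg_cons addrA; apply: IH.
exact: (graded_Lie_deg HL pq (j_deg (xd a))).
Qed.

Lemma nested_move q p b y w : h q p -> h' b y ->
  nested p (y :: map x w) = (-1) ^ (b * wd w) *: br (nest p w) (j y).
Proof.
move=> + yb; elim: w q p => [|a w IH] q p pq.
  by rewrite /word_deg big_nil mulr0 scale1r.
have E : nested p [:: y, x a & map x w] =
    (-1) ^ (b * d a) *: nested (br p (j (x a))) (y :: map x w).
  rewrite !nested_cons (br_swap pq yb (xd a)).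
  by rewrite nestedZ.
rewrite /= E (IH (q + d a)); last exact: (graded_Lie_deg HL pq (j_deg (xd a))).
by rewrite scalerA word_deg_cons mulrDr signzD.
Qed.

(** The Leibniz rule for the right derivations [., x a]: each letter goes
    either to p, crossing p' and the earlier letters that went to p', or to
    p'. *)
Lemma nested_leibniz q r p p' w : increasing w -> h q p -> h r p' ->
  nest (br p p') w = \sum_(t <- unshuffles w)
    ((-1) ^ (r * wd t.1) * inv (t.1 ++ t.2))
      *: br (nest p t.1) (nest p' t.2).
Proof.
elim: w q r p p' => [|a w IH] q r p p'.
  by move=> _ _ _; rewrite big_seq1 /= /word_deg big_nil mulr0 mulr1 scale1r.
move=> /= /andP[aw iw] pq pr; have ya := j_deg (xd a).
rewrite nested_cons (br_right_derivation pq pr ya) nestedD nestedZ.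
rewrite (IH q (r + d a)) //; last exact: (graded_Lie_deg HL pr ya).
rewrite (IH (q + d a) r) //; last exact: (graded_Lie_deg HL pq ya).
rewrite big_cat !big_map addrC scaler_sumr; congr (_ + _);
  apply: eq_big_seq => t tw; have /andP[a1 a2] := unshuffles_all tw aw.
  rewrite scalerA inv_sign_min ?all_cat ?a1 // word_deg_cons.
  by rewrite mulrDr signzD mulrA.
by rewrite inv_sign_mid // mulrDl signzD mulrA.
Qed.

(** y - P y and z - P z lie in ker P, hence so does their bracket; expand it
    and use [P y, P z] = 0. *)
Lemma projection_br y z : P (br y z) = P (br (P y) z) + P (br y (P z)).
Proof.
have PK u : P (u - P u) = 0 by rewrite !Pjc linearB /= jK subrr linear0.
have /= := (V_data_kernel HV).2 _ _ (PK y) (PK z).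
rewrite linearBl !linearBr /= !Pjc br_j subr0 !linearB /= => /eqP.
by rewrite -addrA -opprD subr_eq0 addrC => /eqP.
Qed.

(** The Jacobi sum is the sum TT of the terms T below: moving the element l(u)
    of F from the front to the end of the word produces the sign in T.
    Projecting the Leibniz expansion of the iterated bracket of [D, D] = 0
    gives two sums, by [projection_br]: one is the sum of T by antisymmetry of
    the bracket, the other one is the sum of T over the exchanged splittings. *)
Lemma derived_bracket_jacobi w : increasing w ->
  \sum_(t <- unshuffles w) inv (t.1 ++ t.2)
    *: l (l (map x t.1) :: map x t.2) = 0.
Proof.
move=> iw; have D1 := V_data_deg1 HV.
pose T t := ((-1) ^ (wd t.2 + wd t.1 * wd t.2) * inv (t.1 ++ t.2))
  *: c (br (nest D t.2) (P (nest D t.1))).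
have PD t : c (br (P (nest D t.1)) (nest D t.2)) =
   - (-1) ^ ((1 + wd t.1) * (1 + wd t.2))
   *: c (br (nest D t.2) (P (nest D t.1))).
  rewrite (graded_Lie_antisym HL _ (nested_deg t.2 D1) (i := 1 + wd t.1)).
    by rewrite linearN linearZ scaleNr.
  by rewrite Pjc; apply/j_deg/c_deg/nested_deg.
have cbr y z : c (br y z) = c (br (P y) z) + c (br y (P z)).
  by apply: (can_inj jK); rewrite linearD -!Pjc projection_br.
have TT : \sum_(t <- unshuffles w) T t = 0.
  have E2 : 2%:R *: \sum_(t <- unshuffles w) T t = 0; last first.
    by move/eqP: E2; rewrite scaler_eq0 (negbTE two_neq0) => /eqP.
  rewrite scaler_nat mulr2n.
  rewrite -{2}(perm_big _ (unshuffles_swap w)) big_map -big_split /=.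
  rewrite -[RHS](linear0 c) -(nested0 (map x w)) -(V_data_square HV).
  rewrite (nested_leibniz iw D1 D1) linear_sum /=.
  apply: eq_big_seq => t tw; rewrite linearZ /= cbr PD scalerDr.
  rewrite /T /= (inv_sign_swap K d iw tw) !scalerA; congr (_ *: _ + _ *: _);
    rewrite !signz_if !(odd_abszD, odd_abszM) /=;
    by case: odd; case: odd; cbn; ring.
rewrite -[RHS]TT; apply: eq_big_seq => t tw.
have lt : h' (1 + wd t.1) (l (map x t.1)) by apply/c_deg/nested_deg.
rewrite [l (_ :: _)]/derived_bracket (nested_move _ D1 lt) linearZ /= -Pjc scalerA.
by congr (_ *: _); rewrite mulrC mulrDl mul1r.
Qed.

(** Insertion sort: the first letter of v is moved past the letters of w that
    are smaller, which are those with which it forms an inversion. *)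
Lemma nested_perm q p v w : h q p -> increasing w -> perm_eq v w ->
  nest p v = inv v *: nest p w.
Proof.
elim: v q p w => [|a v IH] q p w pq iw.
  by rewrite perm_sym => /perm_nilP ->; rewrite scale1r.
move=> pv; have aw : a \in w by rewrite -(perm_mem pv) mem_head.
case/splitPr: aw iw pv => w1 w2; rewrite pairwise_cat allrel_consr /=.
case/and3P=> /andP[a1 w12] i1 /andP[a2 i2].
rewrite -[a :: w2]cat1s perm_sym perm_catCA perm_cons perm_sym => pv.
have pa := graded_Lie_deg HL pq (j_deg (xd a)).
rewrite nested_cons (IH _ _ (w1 ++ w2) pa) //; last first.
  by rewrite pairwise_cat w12 i1.
rewrite -nested_cons !map_cat -cat_cons !nested_cat (nested_move _ pq (xd a)).
rewrite -nested_cons nestedZ scalerA inv_sign_cons; congr (_ *: _).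
rewrite mulrC; congr (_ * _).
rewrite (perm_big _ pv) big_cat /= -signzM_prod -[LHS]mulr1; congr (_ * _).
  rewrite big_seq [RHS]big_seq_cond; apply: eq_bigl => b.
  by case: (boolP (b \in w1)) => //= /(allP a1); rewrite /lt_ord => ->.
rewrite big_seq_cond big_pred0 // => b.
by apply/andP => -[/(allP a2)]; rewrite /lt_ord => ab; rewrite ltnNge ltnW.
Qed.

End HigherDerivedBrackets.

(** Voronov's theorem: the higher derived brackets of a V-data form an
    L-infinity structure on F. The number 2 is inverted because the Jacobi sum
    occurs twice in the expansion of [D, D]. *)
Theorem derived_bracket_Linfty (K : fieldType) (L : lmodType K)
  (h : int -> set L) (br : L -> L -> L) (F : set L) (P : L -> L) (D : L)
  (L' : lmodType K) (h' : int -> set L')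
  (j : {linear L' -> L}) (c : {linear L -> L'}) :
  V_data h br F P D -> graded_vect h' -> cancel j c ->
  (forall x, P x = j (c x)) ->
  (forall i x, h' i x -> h i (j x)) -> (forall i x, h i x -> h' i (c x)) ->
  (2%:R : K) != 0 -> Linfty h' (derived_bracket br D j c).
Proof.
move=> HV gh' jK Pjc jd cd two; have D1 := V_data_deg1 HV.
have word_degE n (d : 'I_n -> int) : word_deg d (enum 'I_n) = \sum_(i < n) d i.
  by rewrite /word_deg big_enum.
split=> //.
- move=> s t a x y; rewrite /derived_bracket !nested_cat !nested_cons.
  by rewrite linearP (br_linearr HV) (nested_linear HV) linearP.
- move=> n d x n0 xd; rewrite addrC -word_degE.
  exact/cd/(nested_deg HV jd xd).
- move=> n d x sigma n0 xd; rewrite koszul_inv_sign /derived_bracket.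
  rewrite /perm_word /image_mem (map_comp x sigma).
  rewrite (nested_perm HV jK Pjc jd xd D1 (enum_increasing n)) ?linearZ //.
  exact: perm_map_enum.
move=> n d x n0 xd.
rewrite -[RHS](derived_bracket_jacobi HV jK Pjc jd cd two xd (enum_increasing n)).
rewrite -(shuffles_unshuffles (fun u v => inv_sign K d (u ++ v) *:
  derived_bracket br D j c (derived_bracket br D j c (map x u) :: map x v))).
rewrite [RHS]big_ltn // [X in X + _]big1 ?add0r => [|sigma _]; last first.
  (* The splittings with an empty first word contribute l(c D, ...) = 0. *)
  rewrite take0 /= {2}/derived_bracket /nested /=.
  have -> : c D = 0 by rewrite -[c D]jK -Pjc (V_data_ker HV) linear0.
  rewrite /derived_bracket nested_cons linear0.
  have -> : br D 0 = 0.
    by have := br_linearr HV D (-1) 0 0; rewrite scaler0 add0r scaleN1r addNr.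
  by rewrite (nested0 HV) linear0 scaler0.
apply: eq_bigr => i _; apply: eq_bigr => sigma _.
rewrite koszul_inv_sign cat_take_drop /perm_word /image_mem (map_comp x sigma).
by rewrite map_take map_drop.
Qed.

(** * The V-data on multilinear maps *)

Section Projection.
Variables (K : fieldType) (A A' : lmodType K).
Local Notation W := (A * A')%type.
Local Notation iA := (@inA K A A').
Local Notation iA' := (@inA' K A A').
Local Notation br := (@gerstenhaber K W).
Implicit Types (f g : multimap W W).

Lemma liftFE (f : multimap A' A) s : liftF f s = iA (f (map snd s)).
Proof. by []. Qed.

Lemma compFE f s : compF f s = (f (map iA' s)).1.
Proof. by []. Qed.

Lemma liftF_linear : linear (@liftF K A A').
Proof.
move=> a f g; apply: multimap_ext => s.
by rewrite multimapD multimapZ !liftFE multimapD multimapZ linearP.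
Qed.
HB.instance Definition _ :=
  GRing.isLinear.Build K _ _ *:%R (@liftF K A A') liftF_linear.

Lemma compF_linear : linear (@compF K A A').
Proof. by move=> a f g; apply: multimap_ext => s. Qed.
HB.instance Definition _ :=
  GRing.isLinear.Build K _ _ *:%R (@compF K A A') compF_linear.

Lemma liftFK : cancel (@liftF K A A') (@compF K A A').
Proof.
move=> f; apply: multimap_ext => s; rewrite compFE liftFE /= -map_comp.
by congr (f _); rewrite -[RHS]map_id; apply: eq_map.
Qed.

Lemma liftF_deg i (f : multimap A' A) :
  multimap_deg i f -> multimap_deg i (liftF f).
Proof. by move=> fi s Es; rewrite liftFE fi ?size_map // linear0. Qed.

Lemma compF_deg i f : multimap_deg i f -> multimap_deg i (compF f).
Proof. by move=> fi s Es; rewrite compFE fi ?size_map. Qed.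

Lemma component_liftF i (f : multimap A' A) :
  component i (liftF f) = liftF (component i f).
Proof.
apply: multimap_ext => s; rewrite liftFE /= size_map.
by case: ifP; rewrite ?linear0.
Qed.

Lemma component_compF i f : compF (component i f) = component i (compF f).
Proof.
by apply: multimap_ext => s; rewrite compFE /= size_map; case: ifP.
Qed.

Lemma projF_linear : linear (@projF K A A').
Proof. by move=> a f g; rewrite /projF !linearP. Qed.
HB.instance Definition _ :=
  GRing.isLinear.Build K _ _ *:%R (@projF K A A') projF_linear.

Lemma projF0P f : projF f = 0 <-> forall s, (f (map iA' s)).1 = 0.
Proof.
split=> [f0 s|f0].
  by rewrite -compFE -[compF f]liftFK -[liftF _]/(projF f) f0 linear0.
have -> : projF f = liftF (compF f) by [].
rewrite (_ : compF f = 0) ?linear0 //; apply: multimap_ext => s.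
by rewrite compFE f0.
Qed.

Lemma gerstenhaber_liftF (f g : multimap A' A) : br (liftF f) (liftF g) = 0.
Proof.
have circ0 (f' g' : multimap A' A) m n s :
    circ_at m n (liftF f') (liftF g') s = 0.
  rewrite /circ_at big1 // => i _; rewrite liftFE map_cat /=.
  rewrite (multilinear0 _ _ (@multimap_multilinear _ _ _ f')).
  by rewrite linear0.
apply: multimap_ext => s; rewrite /= /gerstenhaber_fun big1 // => k _.
by rewrite !circ0 scaler0 subr0.
Qed.

Lemma kernel_gerstenhaber f g : projF f = 0 -> projF g = 0 ->
  projF (br f g) = 0.
Proof.
have circ0 (f' g' : multimap W W) m n s : projF f' = 0 -> projF g' = 0 ->
    (circ_at m n f' g' (map iA' s)).1 = 0.
  move=> /projF0P f0 /projF0P g0; rewrite /circ_at linear_sum big1 // => i _.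
  have E t : g' (map iA' t) = iA' (g' (map iA' t)).2.
    by rewrite [LHS]surjective_pairing g0.
  rewrite linearZ /= -map_take -!map_drop -map_take E -map_cons -map_cat f0.
  by rewrite scaler0.
move=> f0 g0; apply/projF0P => s; rewrite /= /gerstenhaber_fun linear_sum.
rewrite big1 // => k _.
by rewrite linearB linearZ /= !circ0 // oppr0 scaler0 addr0.
Qed.

Lemma range_liftF_graded :
  graded_subspace (@multimap_deg K W W) (range (@liftF K A A')).
Proof.
apply: multimap_graded_subspace => [|i _ [f _ <-]]; last first.
  by exists (component i f); rewrite ?component_liftF.
split=> [|a _ _ [f _ <-] [g _ <-]]; first by exists 0; rewrite ?linear0.
by exists (a *: f + g); rewrite ?linearP.
Qed.

Lemma kernel_projF_graded :
  graded_subspace (@multimap_deg K W W) [set f | projF f = 0].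
Proof.
apply: multimap_graded_subspace => [|i f /= f0].
  split=> /= [|a f g f0 g0]; first by rewrite linear0.
  by rewrite linearP /= f0 g0 scaler0 addr0.
by rewrite /projF component_compF -component_liftF -/(projF f) f0 //;
  apply: multimap_ext => s /=; rewrite if_same.
Qed.

Lemma projF_V_data D : projF D = 0 -> multimap_deg 1 D -> br D D = 0 ->
  V_data (@multimap_deg K W W) br (range (@liftF K A A')) (@projF K A A') D.
Proof.
move=> D0 D1 DD; split=> //.
- exact: gerstenhaber_graded_Lie.
- split; first exact: range_liftF_graded.
  by move=> _ _ [f _ <-] [g _ <-]; exists 0; rewrite // linear0 gerstenhaber_liftF.
- by move=> _ _ [f _ <-] [g _ <-]; rewrite gerstenhaber_liftF.
- exact: projF_linear.
- by move=> f; rewrite /projF liftFK.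
- apply/seteqP; split=> [_ [f _ <-]|_ [f _ <-]]; first by exists (compF f).
  by exists (liftF f); rewrite // /projF liftFK.
by split; [exact: kernel_projF_graded | exact: kernel_gerstenhaber].
Qed.
End Projection.

(** * Brackets with maps of degree 0 *)

Section Unary.
Variables (K : fieldType) (W : lmodType K).
Implicit Types (f : multimap W W) (b : {linear W -> W}).
Local Notation br := (@gerstenhaber K W).

Lemma unary_size (U V : lmodType K) (g : {linear U -> V}) :
  of_size 1 (unary g).
Proof. by move=> [|x [|y s]]. Qed.

Lemma binary_size (f : {bilinear W -> W -> W}) : of_size 2 (binary f).
Proof. by move=> [|x [|y [|z s]]]. Qed.

(** The commutator of b with f, as b acts on the value of f and as a
    derivation on its arguments. *)
Lemma unary_gerstenhaber b f s :
  br (unary b) f s = b (f s) - ins 0 (unary b) f s.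
Proof.
move: f; apply: multimap_homogeneous_ind => [|f g Ef Eg|m f fm].
- by rewrite linear0r !multimap0 linear0 ins_eq0 ?subr0.
- rewrite linearDr !multimapD Ef Eg linearD addrACA -opprD; congr (_ - _).
  rewrite -[X in X + _]scale1r -ins_linear; apply: eq_ins => t.
  by rewrite scale1r multimapD.
rewrite (gerstenhaber_ins s (unary_size b) fm) mul0n expr0 scale1r; congr (_ - _).
have [Es|Es] := eqVneq (size s) m.+1; last first.
  rewrite fm // linear0; apply: (ins_size _ fm (unary_size b)) => //.
  exact: multimap_multilinear.
case: s Es => // x s [Es] /=; rewrite -Es take_size drop_size ins_eq0.
  by rewrite scaler0 addr0.
by case.
Qed.

Lemma gerstenhaber_unary b f x y : of_size 2 f ->
  br f (unary b) [:: x; y] = f [:: b x; y] + f [:: x; b y] - b (f [:: x; y]).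
Proof.
move=> f2; rewrite (gerstenhaber_ins _ f2 (unary_size b)) /=.
by rewrite !(scaler0, addr0, scale1r).
Qed.

Lemma gerstenhaber_binary_assoc (f : {bilinear W -> W -> W}) :
  associative f -> br (binary f) (binary f) = 0.
Proof.
move=> fA; apply: multimap_ext => s; rewrite multimap0.
have f2 := binary_size f; have fl := multimap_multilinear (binary f).
rewrite (gerstenhaber_ins _ f2 f2).
have -> : ins 1 (binary f) (binary f) s = 0; last by rewrite scaler0 subrr.
have [Es|Es] := eqVneq (size s) 3; last exact: (ins_size fl f2 f2).
case: s Es => [|x [|y [|z [|? ?]]]] //= _.
by rewrite !(scaler0, addr0) fA expr1 scaleN1r subrr.
Qed.
End Unary.

(** * The Euler element and its eigenspaces *)

Section EulerWeight.
Variables (K : fieldType) (A A' : lmodType K).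
Local Notation W := (A * A')%type.
Local Notation iA := (@inA K A A').
Local Notation iA' := (@inA' K A A').
Local Notation br := (@gerstenhaber K W).
Implicit Types (f g : multimap W W).

Definition projA : {linear W -> W} := iA \o fst.
Definition euler : multimap W W := unary projA.
Definition weighted (lam : K) f := br euler f = lam *: f.

Lemma weightedD lam f g : weighted lam f -> weighted lam g ->
  weighted lam (f + g).
Proof. by move=> Ef Eg; rewrite /weighted linearDr /= Ef Eg scalerDr. Qed.

Lemma euler_derivation f g :
  br euler (br f g) = br (br euler f) g + br f (br euler g).
Proof.
move: f; apply: multimap_homogeneous_ind => [|f1 f2 E1 E2|m f fm].
- by rewrite !(linear0l, linear0r) addr0.
- by rewrite !(linearDl, linearDr) /= E1 E2 addrACA.
move: g; apply: multimap_homogeneous_ind => [|g1 g2 E1 E2|n g gn].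
- by rewrite !(linear0l, linear0r) addr0.
- by rewrite !(linearDl, linearDr) /= E1 E2 addrACA.
rewrite (gerstenhaber_jacobi (unary_size projA) fm gn).
by rewrite mul0n expr0 scale1r.
Qed.

Lemma weighted_br lam nu f g : weighted lam f -> weighted nu g ->
  weighted (lam + nu) (br f g).
Proof.
rewrite /weighted euler_derivation => -> ->.
by rewrite linearZl_LR linearZr_LR /= scalerDl.
Qed.

(** The values lie in A, and changing an argument to its component in A gives
    an argument on which a map of F vanishes. *)
Lemma weighted_liftF (f : multimap A' A) : weighted 1 (liftF f).
Proof.
apply: multimap_ext => s; rewrite unary_gerstenhaber scale1r ins_sum big1.
  by rewrite subr0.
move=> i _; rewrite liftFE map_cat /=.
set z := (X in f (_ ++ X :: _)); have -> : z = 0.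
  by rewrite /z /=; case: drop => [|? []].
rewrite (multilinear0 _ _ (@multimap_multilinear _ _ _ f)).
by rewrite linear0 ?scaler0.
Qed.

Lemma weighted_binary lam (f : {bilinear W -> W -> W}) :
  (forall x y, projA (f x y) - f (projA x) y - f x (projA y) = lam *: f x y) ->
  weighted lam (binary f).
Proof.
move=> H; apply: multimap_ext => s; rewrite unary_gerstenhaber multimapZ.
have [Es|Es] := eqVneq (size s) 2; last first.
  rewrite (binary_size f) // linear0 scaler0 (ins_size _ _ (binary_size f)) ?subr0 //.
    exact: multimap_multilinear.
  exact: unary_size.
case: s Es => [|x [|y [|? ?]]] //= _.
by rewrite -H !(scaler0, addr0, scale1r) opprD addrA.
Qed.

(** The words whose letters lie in A or in A'; multilinear maps are determined
    by their values on them, and the Euler element acts on these values by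
    counting the letters in A. *)
Definition pure (w : seq (A + A')) : seq W :=
  [seq match z with inl a => iA a | inr u => iA' u end | z <- w].
Definition is_inl (z : A + A') := if z is inl _ then true else false.

Lemma multimap_pure_ext f g : (forall w, f (pure w) = g (pure w)) -> f = g.
Proof.
move=> E; apply: multimap_ext => s.
suff H w t : f (pure w ++ t) = g (pure w ++ t) by apply: (H [::]).
elim: t w => [|[a u] t IH] w; first by rewrite cats0.
have -> : (a, u) = 1 *: iA a + iA' u.
  by rewrite scale1r; congr pair; rewrite /= ?addr0 ?add0r.
have Hz z : pure w ++ (match z with inl a => iA a | inr u => iA' u end) :: t =
    pure (rcons w z) ++ t by rewrite /pure map_rcons cat_rcons.
have Ha := Hz (inl a); have Hu := Hz (inr u).
by rewrite !(multimap_multilinear (U := W)) Ha Hu !IH.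
Qed.

Lemma euler_pure f w :
  br euler f (pure w) = iA (f (pure w)).1 - (count is_inl w)%:R *: f (pure w).
Proof.
rewrite unary_gerstenhaber; congr (_ - _).
have := multimap_multilinear f; move: (multimap_fun f) => phi.
elim: w phi => [|z w IH] phi phil /=; first by rewrite scale0r.
rewrite IH; last exact: multilinear_cons.
rewrite take0 drop0 expr0 scale1r natrD scalerDl; congr (_ + _).
case: z => [a|u] /=; first by rewrite scale1r.
by rewrite linear0 (multilinear0 [::]) // scale0r.
Qed.
End EulerWeight.

Section EulerProjection.
Variables (K : fieldType) (A A' : lmodType K).
Local Notation W := (A * A')%type.
Local Notation iA := (@inA K A A').
Local Notation iA' := (@inA' K A A').
Implicit Types (f g : multimap W W).

Lemma natr_eq_char0 m n : [pchar K] =i pred0 ->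
  (m%:R == n%:R :> K) = (m == n).
Proof.
move=> /pcharf0P K0; wlog le_mn : m n / (m <= n)%N => [H|].
  by case/orP: (leq_total m n) => /H // E; rewrite eq_sym E eq_sym.
by rewrite eq_sym -subr_eq0 -natrB // K0 subn_eq0 eqn_leq le_mn.
Qed.

(** On words over A', [E, f] is the component of f in A, which is all that P f
    retains. *)
Lemma projF_weighted lam f : lam != 1 -> weighted lam f -> projF f = 0.
Proof.
move=> lam1 Ef; apply/projF0P => s.
have := euler_pure f (map inr s); rewrite Ef multimapZ.
have -> : pure (map inr s) = map iA' s by rewrite /pure -map_comp.
have -> : count (@is_inl K A A') (map inr s) = 0%N.
  by rewrite count_map; elim: s.
rewrite scale0r subr0 => /(congr1 fst) /= /eqP.
rewrite -subr_eq0 -{2}[(f _).1]scale1r -scalerBl scaler_eq0 subr_eq0.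
by rewrite (negbTE lam1) => /eqP.
Qed.

(** If a word has n letters in A and y is the value of f on it, with component
    y1 in A, the eigenvalue equation reads y1 - n y = y.  For n = 0 this says
    that y lies in A; for n > 0 it forces y = 0, as n and n + 1 are invertible
    in characteristic 0. *)
Lemma projF_weighted1 f : [pchar K] =i pred0 -> weighted 1 f -> projF f = f.
Proof.
move=> K0 Ef; apply: multimap_pure_ext => w.
have := euler_pure f w; rewrite Ef multimapZ scale1r => /eqP.
rewrite eq_sym subr_eq => /eqP Ew; rewrite liftFE compFE -map_comp.
have [n0|] := posnP (count (@is_inl K A A') w).
  have -> : map (iA' \o snd) (pure w) = pure w.
    rewrite -[RHS]map_id /pure -!map_comp; apply/eq_in_map => -[a|u] zw //=.
    have : has (@is_inl K A A') w by apply/hasP; exists (inl a).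
    by rewrite has_count n0.
  by rewrite [RHS](_ : _ = iA (f (pure w)).1) // [RHS]Ew n0 scale0r addr0.
move=> n_gt0; have -> : f (pure w) = 0.
  set y := f (pure w) in Ew *; set k := count _ _ in Ew n_gt0.
  have := congr1 fst Ew; have := congr1 snd Ew => /=.
  rewrite -{1}[y.2]scale1r -scalerDl => /esym/eqP.
  have natr0 m : (m%:R == 0 :> K) = (m == 0%N) by apply: natr_eq_char0 m 0 K0.
  rewrite scaler_eq0 addrC natr1 natr0 /= => /eqP y2.
  rewrite -{1}[y.1]addr0 => /addrI/esym/eqP.
  rewrite scaler_eq0 natr0 eqn0Ngt n_gt0 /= => /eqP y1.
  by rewrite [y]surjective_pairing y1 y2.
have /hasP[z zw] : has (@is_inl K A A') w by rewrite has_count.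
case: z zw => // a /splitPr[w1 w2] _; rewrite /pure !map_cat /=.
by rewrite linear0 (multilinear0 _ _ (@multimap_multilinear _ _ _ f)) linear0.
Qed.
End EulerProjection.

(** * The multiplication of a quasi-twilled algebra *)

Section QuasiTwilledDelta.
Variables (K : fieldType) (A A' : lmodType K) (Q : quasi_twilled A A').
Local Notation W := (A * A')%type.
Local Notation br := (@gerstenhaber K W).

(** The summands of Omega by eigenvalue 0, -1 and -2 of the Euler element. *)
Definition Delta0 := lift_xi Q + lift_eta Q + lift_beta Q.
Definition Delta1 := lift_pi Q + lift_rho Q + lift_mu Q.
Definition Delta2 := lift_theta Q.

Lemma sum_lifts_Omega :
  lift_pi Q + lift_xi Q + lift_eta Q + lift_beta Q + lift_rho Q + lift_mu Q
  + lift_theta Q = binary (Omega Q).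
Proof.
apply: multimap_ext => s; rewrite !multimapD.
case: s => [|[x u] [|[y v] [|? ?]]]; try by rewrite /= !addr0.
by rewrite [RHS]/= OmegaE /= /bicomp /=; congr pair; rewrite /= ?addr0 ?add0r.
Qed.

Lemma sum_lifts_Delta :
  lift_pi Q + lift_xi Q + lift_eta Q + lift_beta Q + lift_rho Q + lift_mu Q
  + lift_theta Q = Delta0 + Delta1 + Delta2.
Proof. by rewrite /Delta0 /Delta1 /Delta2; lmodule_eq K (multimap W W); ring. Qed.

Lemma Delta0_weight : weighted 0 Delta0.
Proof.
apply: weightedD; [apply: weightedD|]; apply: weighted_binary => x y;
  rewrite scale0r /bicomp /=.
all: by congr pair; rewrite /= ?linear0 ?linear0l ?linear0r ?subr0 ?subrr ?addr0.
Qed.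

Lemma Delta1_weight : weighted (-1) Delta1.
Proof.
apply: weightedD; [apply: weightedD|]; apply: weighted_binary => x y;
  rewrite scaleN1r /bicomp /=.
all: by congr pair; rewrite /= ?linear0 ?linear0l ?linear0r ?subr0 ?subrr ?sub0r
  ?addr0.
Qed.

Lemma Delta2_weight : weighted (- 2%:R) Delta2.
Proof.
apply: weighted_binary => x y; rewrite /bicomp /=.
by congr pair; rewrite /= ?scaler0 ?subr0 // sub0r -opprD scaleNr scaler_nat.
Qed.

End QuasiTwilledDelta.

(** * The brackets and the Maurer-Cartan equation *)

Section MaurerCartan.
Variables (K : fieldType) (A A' : lmodType K) (Q : quasi_twilled A A').
Hypothesis charK : [pchar K] =i pred0.
Local Notation W := (A * A')%type.
Local Notation iA := (@inA K A A').
Local Notation iA' := (@inA' K A A').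
Local Notation br := (@gerstenhaber K W).
Local Notation Om := (Omega Q).
Local Notation Delta := (binary Om).

Lemma Omega_V_data :
  V_data (@multimap_deg K W W) br (range (@liftF K A A')) (@projF K A A') Delta.
Proof.
apply: projF_V_data.
- apply/projF0P => -[|u [|v [|? ?]]] //=; exact: Omega_subalg.
- exact/multimap_degP/binary_size.
exact/gerstenhaber_binary_assoc/Omega_assoc.
Qed.

Definition twilled_bracket : seq (multimap A' A) -> multimap A' A :=
  derived_bracket br Delta (@liftF K A A') (@compF K A A').
Local Notation l := twilled_bracket.
Local Notation nest := (nested br (@liftF K A A')).

Lemma weighted_nested lam D s : weighted lam D ->
  weighted (lam + (size s)%:R) (nest D s).
Proof.
elim: s lam D => [|f s IH] lam D Dlam; first by rewrite addr0.
rewrite nested_cons /= -nat1r addrA; apply: IH.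
exact/weighted_br/weighted_liftF.
Qed.

Lemma projF_nested k D s : weighted (- k%:R) D ->
  projF (nest D s) = if size s == k.+1 then nest D s else 0.
Proof.
move=> Dk; have := weighted_nested s Dk.
have [->|sk] := eqVneq (size s) k.+1.
  by rewrite -natr1 addrA addNr add0r; apply: projF_weighted1.
apply: projF_weighted; apply: contra sk.
by rewrite addrC subr_eq nat1r natr_eq_char0.
Qed.

(** The iterated bracket of Delta_i with k elements of F has eigenvalue k - i,
    so that P keeps the summand with i = k - 1 and kills the others. *)
Lemma twilled_bracketE s : liftF (l s) =
  nth 0 [:: nest (Delta0 Q) s; nest (Delta1 Q) s; nest (Delta2 Q) s]
    (size s).-1 *+ (size s != 0).
Proof.
have HV := Omega_V_data.
rewrite -[LHS]/(projF (nest Delta s)) -sum_lifts_Omega sum_lifts_Delta.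
have PD f g : @projF K A A' (f + g) = projF f + projF g by rewrite linearD.
rewrite 2!(nestedD HV) 2!PD.
have W0 : weighted (- 0%:R) (Delta0 Q) by rewrite oppr0; apply: Delta0_weight.
rewrite (projF_nested s W0) (@projF_nested 1 _ s (Delta1_weight Q)).
rewrite (projF_nested s (Delta2_weight Q)).
by case: (size s) => [|[|[|[|k]]]] /=; rewrite ?nth_nil ?addr0 ?add0r.
Qed.

Lemma twilled_bracket_Linfty : Linfty (@multimap_deg K A' A) l.
Proof.
apply: (derived_bracket_Linfty Omega_V_data).
- exact: multimap_graded_vect.
- exact: liftFK.
- by [].
- exact: liftF_deg.
- exact: compF_deg.
by rewrite (natr_eq_char0 2 0).
Qed.

Variable B : {linear A' -> A}.
Definition liftB : {linear W -> W} := iA \o B \o snd.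

Lemma liftF_unary : liftF (unary B) = unary liftB.
Proof.
by apply: multimap_ext => -[|x [|y s]]; rewrite liftFE //= linear0.
Qed.

Local Notation b := liftB.
Local Notation twist k := (iter k (br^~ (unary b)) Delta).

Lemma nested_nseq k D :
  nest D (nseq k (unary B)) = iter k (br^~ (unary b)) D.
Proof.
elim: k D => // k IH D; rewrite iterSr -IH /= nested_cons.
by rewrite -liftF_unary.
Qed.

Lemma twist_size k : of_size 2 (twist k).
Proof.
elim: k => [|k IH]; first exact: binary_size.
exact: (gerstenhaber_size IH (unary_size b)).
Qed.

Lemma twistS k x y : twist k.+1 [:: x; y] =
  twist k [:: b x; y] + twist k [:: x; b y] - b (twist k [:: x; y]).
Proof. exact/gerstenhaber_unary/twist_size. Qed.

Lemma liftB_square x : b (b x) = 0.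
Proof. by rewrite /b /= linear0. Qed.

Lemma twist1E x y :
  twist 1 [:: x; y] = Om (b x) y + Om x (b y) - b (Om x y).
Proof. by rewrite twistS. Qed.

(** As b b = 0, each iterated commutator is a combination of the terms in
    which b acts on the arguments and on the value at most once. *)
Lemma twist2E x y : twist 2 [:: x; y] =
  2%:R *: (Om (b x) (b y) - b (Om (b x) y) - b (Om x (b y))).
Proof.
rewrite twistS !twist1E !(linearD b) !(linearN b) !liftB_square.
rewrite linear0l linear0r.
by lmodule_eq K (A * A')%type; ring.
Qed.

Lemma twist3E x y : twist 3 [:: x; y] = - 6%:R *: b (Om (b x) (b y)).
Proof.
have bZ c z : b (c *: z) = c *: b z by rewrite linearZ.
rewrite twistS !twist2E !bZ !(linearD b) !(linearN b).
rewrite !liftB_square !(linear0l, linear0r) (linear0 b).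
by lmodule_eq K (A * A')%type; ring.
Qed.

Definition maurer_cartan_sum : multimap A' A :=
  \sum_(1 <= k < 4) (k`!%:R : K)^-1 *: l (nseq k (unary B)).

(** The factorials cancel the coefficients 2 and -6 of [twist2E] and
    [twist3E]. *)
Lemma maurer_cartan_sumE u v : maurer_cartan_sum [:: u; v] =
  (qt_pi Q (B u) (B v) + qt_xi Q (B u) v + qt_eta Q u (B v)) -
  B (qt_beta Q u v + qt_rho Q (B u) v + qt_mu Q u (B v)
     + qt_theta Q (B u) (B v)).
Proof.
have natr0 m : (m%:R == 0 :> K) = (m == 0%N) by apply: natr_eq_char0 m 0 charK.
have E k : l (nseq k (unary B)) [:: u; v] = (twist k [:: iA' u; iA' v]).1.
  by rewrite -nested_nseq.
have S3 (F : nat -> multimap A' A) : \sum_(1 <= k < 4) F k = F 1 + F 2 + F 3.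
  by rewrite 3?big_ltn // big_geq // addr0 addrA.
rewrite /maurer_cartan_sum S3.
rewrite 2!multimapD 3!multimapZ.
rewrite 3!E twist1E twist2E twist3E.
rewrite (_ : 1`! = 1%N) // (_ : 2`! = 2%N) // (_ : 3`! = 6%N) // invr1 scale1r.
have fstZ a (z : W) : (a *: z).1 = a *: z.1 by [].
rewrite !fstZ !scalerA mulrN !mulVf ?natr0 // scale1r scaleN1r.
(* The components of Omega are by definition projections of its values, and
   the component in A of b w is B applied to the component of w in A'. *)
change (qt_xi Q (B u) v + qt_eta Q u (B v) - B (qt_beta Q u v)
  + (qt_pi Q (B u) (B v) - B (qt_rho Q (B u) v) - B (qt_mu Q u (B v)))
  - B (qt_theta Q (B u) (B v)) =
  qt_pi Q (B u) (B v) + qt_xi Q (B u) v + qt_eta Q u (B v)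
  - B (qt_beta Q u v + qt_rho Q (B u) v + qt_mu Q u (B v)
       + qt_theta Q (B u) (B v))).
by rewrite 3!(linearD B); lmodule_eq K A; ring.
Qed.

Lemma twilled_bracket_gt3 s : (3 < size s)%N -> l s = 0.
Proof.
move=> s3; apply: (can_inj (@liftFK K A A')).
rewrite twilled_bracketE linear0.
by case: (size s) s3 => [|[|[|[|k]]]] //= _; rewrite nth_nil.
Qed.

(** All brackets of more than three elements vanish, so the partial sums of
    the Maurer-Cartan series are constant from the third one on; the sum is a
    map of two arguments. *)
Lemma maurer_cartan_left_deformation :
  left_deformation_map Q B <-> maurer_cartan (@multimap_deg K A' A) l (unary B).
Proof.
have tail m : (3 <= m)%N ->
    \sum_(1 <= k < m.+1) (k`!%:R : K)^-1 *: l (nseq k (unary B)) =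
    maurer_cartan_sum.
  move=> m3; rewrite (@big_cat_nat _ _ _ 4) //= [X in _ + X]big_nat_cond.
  rewrite [X in _ + X]big1 ?addr0 // => k /andP[/andP[k4 _] _].
  by rewrite twilled_bracket_gt3 ?scaler0 // size_nseq.
have -> : maurer_cartan (@multimap_deg K A' A) l (unary B) <->
    maurer_cartan_sum = 0.
  split=> [[_ [N HN]]|S0].
    by rewrite -(tail (maxn N 3)) ?leq_maxr // HN // leq_maxl.
  split; first exact/multimap_degP/unary_size.
  by exists 3 => m m3; rewrite tail.
split=> [H|S0 u v].
  apply: multimap_ext => s; rewrite multimap0.
  have [Es|Es] := eqVneq (size s) 2; last first.
    rewrite /maurer_cartan_sum multimap_sumE big1 // => k _.
    rewrite multimapZ compFE nested_nseq twist_size ?size_map //.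
    exact: scaler0.
  case: s Es => [|u [|v [|? ?]]] //= _; rewrite maurer_cartan_sumE.
  by rewrite H subrr.
by apply/eqP; rewrite -subr_eq0 -maurer_cartan_sumE S0.
Qed.
End MaurerCartan.

Theorem theorem4p10 (K : fieldType) (charK : [pchar K] =i pred0)
    (A A' : lmodType K) (Q : quasi_twilled A A') :
  V_data (@multimap_deg K (A * A')%type (A * A')%type)
    (@gerstenhaber K (A * A')%type) (range (@liftF K A A')) (@projF K A A')
    (lift_pi Q + lift_xi Q + lift_eta Q + lift_beta Q + lift_rho Q + lift_mu Q
     + lift_theta Q) /\
  exists l : seq (multimap A' A) -> multimap A' A,
    [/\ forall f, liftF (l [:: f]) =
          gerstenhaber (lift_xi Q + lift_eta Q + lift_beta Q) (liftF f),
        forall f1 f2, liftF (l [:: f1; f2]) =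
          gerstenhaber
            (gerstenhaber (lift_pi Q + lift_rho Q + lift_mu Q) (liftF f1))
            (liftF f2),
        forall f1 f2 f3, liftF (l [:: f1; f2; f3]) =
          gerstenhaber
            (gerstenhaber (gerstenhaber (lift_theta Q) (liftF f1)) (liftF f2))
            (liftF f3),
        forall s, (3 < size s)%N -> l s = 0
      & Linfty (@multimap_deg K A' A) l /\
        forall B : {linear A' -> A},
          left_deformation_map Q B <->
          maurer_cartan (@multimap_deg K A' A) l (unary B)].
Proof.
split; first by rewrite sum_lifts_Omega; apply: Omega_V_data.
exists (twilled_bracket Q); split.
- by move=> f; rewrite twilled_bracketE.
- by move=> f1 f2; rewrite twilled_bracketE.
- by move=> f1 f2 f3; rewrite twilled_bracketE.
- by move=> s; apply: twilled_bracket_gt3.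
split; first exact: twilled_bracket_Linfty.
by move=> B; apply: maurer_cartan_left_deformation.
Qed.
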